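(* Let $\mathcal{P}$ be a convex polyhedron. Let $\mathcal{Q}$ be a convex polyhedron obtained by attaching the base of a pyramid with apex $v$ to a face $F$ of $\mathcal{P}$ so that all the edges and vertices of the face $F$ vanish. Assume that (1) $\mathcal{Q}$ is coherently labellable; (2) every coherent labelling of $\mathcal{Q}$ is clockwise coherent at the vertex $v$ of $\mathcal{Q}$. Then the polyhedron $\mathcal{P}$, which is obtained by chopping off the vertex $v$ of $\mathcal{Q}$, is not coherently labellable.
   Context: For a convex polyhedron, each face $F$ is oriented by the outward normal, so its boundary edges are traversed anticlockwise as seen from outside. A labelling of all the edges by integers is coherent if, for each face $F$ with $n_F$ edges, there is a choice of starting edge such that the successive labels read anticlockwise from that edge satisfy $a_1<a_2<\cdots<a_{n_F}$. The polyhedron is coherently labellable if it has a coherent labelling. A labelling is clockwise coherent at a vertex $v$ if there is a choice of starting edge at $v$ such that, traversing the edges incident to $v$ once around $v$ clockwise as seen from outside, starting with that edge, the labels are strictly increasing (no condition being imposed from the last edge back to the first). An edge or vertex of $F$ vanishes if it is no longer an edge or vertex of $\mathcal{Q}$. So each lateral triangle of the pyramid is coplanar with, and merges into, the face of $\mathcal{P}$ adjacent to $F$ along the corresponding edge, and at each vertex of $F$ the single edge of $\mathcal{P}$ not in $F$ is extended straight to $v$. Equivalently, $\mathcal{P}$ is obtained from $\mathcal{Q}$ by cutting off $v$ with a plane crossing the interiors of exactly the edges of $\mathcal{Q}$ incident to $v$, with $F$ the newly created face. *)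

(* Defs.v *)
From HB Require Import structures.
From mathcomp Require Import all_boot all_order all_algebra.
From mathcomp Require Import boolp classical_sets functions cardinality reals convex.

Set Implicit Arguments.
Unset Strict Implicit.
Unset Printing Implicit Defensive.
Import Order.TTheory GRing.Theory Num.Theory.
Local Open Scope classical_set_scope.
Local Open Scope ring_scope.

Section Polyhedra.
Context {R : realType}.
Local Notation V := 'rV[R]_3.
Implicit Types (P Q F E S A : set V) (a p q v x y : V) (L : set V -> int).

Definition dot a x : R := (a *m x^T) 0 0.

(* Triple product a . (p x q) in the standard (right-handed) coordinates of
   R^3: it is positive iff, seen from the tip of a, the projection of q along
   a lies anticlockwise from that of p (by an angle less than pi). *)
Definition triple a p q : R := \det (\matrix_(i < 3) [:: a; p; q]`_i).

Definition hull A : set V := smallest (@convex_set R V) A.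

Definition segment p q : set V := hull [set p; q].

(* The affine hull of S has dimension d: it is x + <the d independent rows of
   M>, where x and the x + row i M can be taken in S. *)
Definition has_dim (d : nat) S : Prop :=
  exists2 x, S x & exists M : 'M[R]_(d, 3),
    [/\ row_free M, forall i, S (x + row i M)
      & forall y, S y -> (y - x <= M)%MS].

Definition convex_polyhedron P : Prop :=
  (exists2 A, finite_set A & P = hull A) /\ has_dim 3 P.

(* a is an outward normal of a plane which supports P and meets it in S. *)
Definition outward_normal P S a : Prop :=
  a != 0 /\ exists2 b, forall x, P x -> dot a x <= b
                     & S = P `&` [set x | dot a x = b].

Definition face_of_dim (d : nat) P S : Prop :=
  (exists a, outward_normal P S a) /\ has_dim d S.

Definition vertex P v : Prop := face_of_dim 0 P [set v].
Definition edge P E : Prop := face_of_dim 1 P E.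
Definition face P F : Prop := face_of_dim 2 P F.

(* The cyclic sequence us lists the vertices of F so that every edge of F is
   traversed exactly once, as segment p (next us p), with F on its left as
   seen from outside P. *)
Definition anticlockwise_boundary P F (us : seq V) : Prop :=
  [/\ uniq us,
      forall E, edge P E /\ E `<=` F <->
        exists2 p, p \in us & E = segment p (next us p)
    & exists2 a, outward_normal P F a &
        forall p x, p \in us -> F x -> 0 <= triple a (next us p - p) (x - p)].

(* A labelling is a function on all sets of points, of which only the values
   at edges matter.  The choice of a starting edge of F is the choice of us
   among its rotations. *)
Definition coherent P L : Prop :=
  forall F, face P F -> exists2 us, anticlockwise_boundary P F us
    & sorted <%R [seq L (segment p (next us p)) | p <- us].

Definition coherently_labellable P : Prop := exists L, coherent P L.

(* The edges at the vertex v are the segments from v to the points of ws, each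
   followed by the next one in clockwise order around v as seen from outside:
   the two lie in a common face G, and the turn from the first to the second
   is clockwise as seen from the outer side of G. *)
Definition clockwise_around P v (ws : seq V) : Prop :=
  [/\ uniq ws,
      forall E, edge P E /\ E v <-> exists2 w, w \in ws & E = segment v w
    & forall w, w \in ws -> exists G a,
        [/\ face P G, outward_normal P G a,
            segment v w `<=` G, segment v (next ws w) `<=` G
          & triple a (w - v) (next ws w - v) < 0]].

Definition clockwise_coherent_at P L v : Prop :=
  exists2 ws, clockwise_around P v ws
    & sorted <%R [seq L (segment v w) | w <- ws].

Definition pyramid F v : set V := hull (v |` F).

(* Q is P with a pyramid of base F and apex v glued on the outer side of F,
   and no edge or vertex of F is an edge or vertex of Q. *)
Definition attach_pyramid P F v Q : Prop :=
  [/\ exists2 a, outward_normal P F a & forall x, F x -> dot a x < dot a v,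
      Q = P `|` pyramid F v,
      forall E, edge P E -> E `<=` F -> ~ edge Q E
    & forall u, vertex P u -> F u -> ~ vertex Q u].

End Polyhedra.

(* Main.v *)
Require Import Defs.
From mathcomp Require Import all_boot all_order all_algebra.
From mathcomp Require Import boolp classical_sets reals.
From mathcomp Require Import cardinality interval_inference convex ring lra.

(** Suppose that [L] is a coherent labelling of [P].

    Beyond the base [F], the faces and edges of [P] other than [F] and its edges are
    prolonged to the faces and edges of [Q], which are recovered by intersecting
    with [P] ([edge_prolong], [edge_trace], [face_trace]).  This rests on two facts.
    A half-space which supports [P] at a point outside of [F] also contains the apex,
    because the segment from that point to the apex crosses [F] ([supports_apex]);
    and a face of a face of a polytope is a face ([face_of_face]), so that whatever
    survived of [F] in the boundary of a face of [Q] would be an edge or a vertex of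
    [Q], against the assumption that they all vanish.

    Going around a face of [Q] through the apex, one meets the same edges as in [P]
    except for one edge of [F], which is skipped ([boundary_prolong]).  As a sublist of
    an increasing list is increasing, giving to an edge [E] of [Q] the label in [P] of
    the edge [E `&` P] is a coherent labelling of [Q] ([coherent_trace]).  By
    assumption, it is then clockwise coherent at the apex: the edges at the apex carry,
    in clockwise order, increasing labels [e_1 < ... < e_n].

    Let [f_i] be the label of the edge of [F] between the [i]-th edge at the apex and
    the next one.  These three edges are consecutive in a face of [P], so that [e_i],
    [f_i], [e_(i+1)] are in increasing cyclic order ([corner]).  The cases [n <= 2] are
    degenerate.  Otherwise [e_1 < f_1 < e_2 < f_2 < e_3], while [f_n] is above [e_n] or below [e_1], and
    [f_n], [f_1], [f_2] are in increasing cyclic order.  But the anticlockwise boundary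
    of [F] passes through these three edges in the order [f_2], [f_1], [f_n], since two
    adjacent faces traverse their common edge in opposite directions
    ([opposite_turns]); so the labels around [F] are not coherent. *)

Set Implicit Arguments.
Unset Strict Implicit.
Unset Printing Implicit Defensive.
Import Order.TTheory GRing.Theory Num.Theory.
Local Open Scope classical_set_scope.
Local Open Scope ring_scope.

(** * Scalar and triple products, convex sets, segments *)

Section Vectors.
Context {R : realType}.
Local Notation V := 'rV[R]_3.
Implicit Types (a c m n p q v w x y z : V) (k l s t : R) (A B : set V).

(** The three coordinates. *)
Definition crd0 x := x 0 0.
Definition crd1 x := x 0 1.
Definition crd2 x := x 0 (2%:R : 'I_3).

Lemma eq_coord x y : crd0 x = crd0 y -> crd1 x = crd1 y -> crd2 x = crd2 y -> x = y.
Proof.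
rewrite /crd0 /crd1 /crd2 => e0 e1 e2; apply/rowP => -[[|[|[|//]]] i].
- by rewrite (_ : Ordinal i = 0) //; apply/val_inj.
- by rewrite (_ : Ordinal i = 1) //; apply/val_inj.
- by rewrite (_ : Ordinal i = 2%:R) //; apply/val_inj.
Qed.

Lemma crd0D x y : crd0 (x + y) = crd0 x + crd0 y. Proof. by rewrite /crd0 mxE. Qed.
Lemma crd1D x y : crd1 (x + y) = crd1 x + crd1 y. Proof. by rewrite /crd1 mxE. Qed.
Lemma crd2D x y : crd2 (x + y) = crd2 x + crd2 y. Proof. by rewrite /crd2 mxE. Qed.
Lemma crd0N x : crd0 (- x) = - crd0 x. Proof. by rewrite /crd0 mxE. Qed.
Lemma crd1N x : crd1 (- x) = - crd1 x. Proof. by rewrite /crd1 mxE. Qed.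
Lemma crd2N x : crd2 (- x) = - crd2 x. Proof. by rewrite /crd2 mxE. Qed.
Lemma crd0Z k x : crd0 (k *: x) = k * crd0 x. Proof. by rewrite /crd0 mxE. Qed.
Lemma crd1Z k x : crd1 (k *: x) = k * crd1 x. Proof. by rewrite /crd1 mxE. Qed.
Lemma crd2Z k x : crd2 (k *: x) = k * crd2 x. Proof. by rewrite /crd2 mxE. Qed.
Lemma crd00 : crd0 0 = 0. Proof. by rewrite /crd0 mxE. Qed.
Lemma crd10 : crd1 0 = 0. Proof. by rewrite /crd1 mxE. Qed.
Lemma crd20 : crd2 0 = 0. Proof. by rewrite /crd2 mxE. Qed.
Definition coordE := (crd00, crd10, crd20, crd0D, crd1D, crd2D,
  crd0N, crd1N, crd2N, crd0Z, crd1Z, crd2Z).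

Lemma dotE a x : dot a x = crd0 a * crd0 x + crd1 a * crd1 x + crd2 a * crd2 x.
Proof.
rewrite /dot mxE !big_ord_recr big_ord0 /= !mxE add0r /crd0 /crd1 /crd2.
by congr (a _ _ * x _ _ + a _ _ * x _ _ + a _ _ * x _ _); apply/val_inj.
Qed.

Lemma tripleE a p q : triple a p q =
  crd0 a * (crd1 p * crd2 q - crd2 p * crd1 q) - crd1 a * (crd0 p * crd2 q - crd2 p * crd0 q)
  + crd2 a * (crd0 p * crd1 q - crd1 p * crd0 q).
Proof.
have det3 (M : 'M[R]_3) : \det M =
   M 0 0 * (M 1 1 * M 2%:R 2%:R - M 1 2%:R * M 2%:R 1)
 - M 0 1 * (M 1 0 * M 2%:R 2%:R - M 1 2%:R * M 2%:R 0)
 + M 0 2%:R * (M 1 0 * M 2%:R 1 - M 1 1 * M 2%:R 0).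
  rewrite (expand_det_row _ 0) !big_ord_recr big_ord0 /= add0r /cofactor.
  rewrite !(expand_det_row _ ord0) !big_ord_recr !big_ord0 /= !add0r /cofactor.
  rewrite !det_mx11 !mxE /= !(expr0, expr1, expr2, addn0, add0n).
  pose g (i j : nat) := M (inord i) (inord j).
  have E (i j : 'I_3) : M i j = g i j by rewrite /g !inord_val.
  by rewrite !E /= /bump /=; ring.
by rewrite /triple det3 !mxE /= /crd0 /crd1 /crd2; ring.
Qed.

Lemma dotDr a x y : dot a (x + y) = dot a x + dot a y.
Proof. by rewrite !dotE !coordE; ring. Qed.
Lemma dotBr a x y : dot a (x - y) = dot a x - dot a y.
Proof. by rewrite !dotE !coordE; ring. Qed.
Lemma dotZr a k x : dot a (k *: x) = k * dot a x.
Proof. by rewrite !dotE !coordE; ring. Qed.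
Lemma dotDl a c x : dot (a + c) x = dot a x + dot c x.
Proof. by rewrite !dotE !coordE; ring. Qed.
Lemma dotZl k a x : dot (k *: a) x = k * dot a x.
Proof. by rewrite !dotE !coordE; ring. Qed.
Lemma dotNl a x : dot (- a) x = - dot a x.
Proof. by rewrite !dotE !coordE; ring. Qed.
Lemma dot0l x : dot 0 x = 0.
Proof. by rewrite dotE !coordE; ring. Qed.
Lemma dotC x y : dot x y = dot y x.
Proof. by rewrite !dotE; ring. Qed.

Lemma dotxx_gt0 x : x != 0 -> 0 < dot x x.
Proof.
move=> x0; have : 0 <= dot x x by rewrite dotE !addr_ge0 // -expr2 sqr_ge0.
rewrite le_eqVlt => /orP[/eqP|//]; rewrite dotE => h.
case/negP: x0; apply/eqP/eq_coord; rewrite coordE; nra.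
Qed.

Lemma dotxx_eq0 x : dot x x = 0 -> x = 0.
Proof.
by move=> h; apply/eqP/negP => /negP /dotxx_gt0; rewrite h ltxx.
Qed.

(** The product of two determinants is the determinant of scalar products. *)
Lemma triple_gram a p q x y z : triple a p q * triple x y z =
  dot a x * (dot p y * dot q z - dot p z * dot q y)
  - dot a y * (dot p x * dot q z - dot p z * dot q x)
  + dot a z * (dot p x * dot q y - dot p y * dot q x).
Proof. by rewrite !tripleE !dotE; ring. Qed.

Lemma triple_cramer a p q x :
  triple a p q *: x
  = triple x p q *: a + triple a x q *: p + triple a p x *: q.
Proof. by apply: eq_coord; rewrite !coordE !tripleE; ring. Qed.

(** Two vectors of the plane normal to [a] are parallel when they span no area. *)
Lemma triple_eq0 a m n : a != 0 -> m != 0 -> dot a m = 0 -> dot a n = 0 ->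
  triple a m n = 0 -> exists k, n = k *: m.
Proof.
move=> a0 m0 am an t0; exists (dot m n / dot m m).
have mm := dotxx_gt0 m0; have aa := dotxx_gt0 a0.
have := triple_gram a m n a m n; rewrite t0 am an mul0r => g.
have {}g : dot m m * dot n n = dot m n ^+ 2.
  rewrite [dot n m]dotC in g; rewrite expr2; apply/eqP; rewrite -subr_eq0.
  apply/eqP/(mulfI (lt0r_neq0 aa)); rewrite mulr0; lra.
apply/eqP; rewrite -subr_eq0; apply/eqP/dotxx_eq0.
set k := _ / _; have kE : k * dot m m = dot m n by rewrite /k divfK // lt0r_neq0.
have -> : dot (n - k *: m) (n - k *: m)
   = dot n n - 2 * k * dot m n + k * (k * dot m m).
  by rewrite !dotE !coordE; ring.
rewrite kE; apply: (mulfI (lt0r_neq0 mm)); rewrite mulr0.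
have -> : dot m m * (dot n n - 2 * k * dot m n + k * dot m n)
   = dot m m * dot n n - (k * dot m m) * dot m n by ring.
by rewrite g kE; ring.
Qed.

(** Two independent vectors of the plane normal to [a] span it. *)
Lemma triple_span a m n x : a != 0 -> dot a m = 0 -> dot a n = 0 ->
  triple a m n != 0 -> dot a x = 0 -> exists k l, x = k *: m + l *: n.
Proof.
move=> a0 am an t0 ax.
have aa := dotxx_gt0 a0; have cr := triple_cramer a m n x.
have x0 : triple x m n = 0.
  have := congr1 (dot a) cr; rewrite !dotDr !dotZr am an ax !mulr0 !addr0.
  by move/esym/eqP; rewrite mulf_eq0 (negPf (lt0r_neq0 aa)) orbF => /eqP.
exists (triple a x n / triple a m n), (triple a m x / triple a m n).
apply: (scalerI t0); rewrite cr x0 scale0r add0r scalerDr !scalerA.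
by rewrite ![_ * (_ / _)]mulrC !divfK.
Qed.

Lemma triplexx a m : triple a m m = 0.
Proof. by rewrite tripleE; ring. Qed.
Lemma triple_swap a m n : triple a n m = - triple a m n.
Proof. by rewrite !tripleE; ring. Qed.
Lemma tripleDr a m x y : triple a m (x + y) = triple a m x + triple a m y.
Proof. by rewrite !tripleE !coordE; ring. Qed.
Lemma tripleZr a m k x : triple a m (k *: x) = k * triple a m x.
Proof. by rewrite !tripleE !coordE; ring. Qed.
Lemma tripleZl a m k x : triple a (k *: m) x = k * triple a m x.
Proof. by rewrite !tripleE !coordE; ring. Qed.
Lemma tripleZn a m k x : triple (k *: a) m x = k * triple a m x.
Proof. by rewrite !tripleE !coordE; ring. Qed.

Lemma triple_neq0 a m n : triple a m n != 0 -> m != 0.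
Proof.
apply: contraNneq => ->; rewrite tripleE !coordE; apply/eqP; ring.
Qed.

(** The point dividing the segment from [y] to [x] in the ratio [t : 1 - t]. *)
Definition mix t x y : V := t *: x + (1 - t) *: y.

Lemma dot_mix a t x y : dot a (mix t x y) = t * dot a x + (1 - t) * dot a y.
Proof. by rewrite /mix dotDr !dotZr. Qed.

(** Convexity without the packed coefficients of [convex_set]. *)
Definition is_convex (A : set V) :=
  forall t x y, 0 <= t -> t <= 1 -> A x -> A y -> A (mix t x y).

Lemma convex_setE A : @convex_set R V A <-> is_convex A.
Proof.
split=> [cA t x y t0 t1 /mem_set Ax /mem_set Ay|cA x y t /set_mem Ax /set_mem Ay].
  by have := cA x y (Itv01 t0 t1) Ax Ay => /set_mem.
by apply/mem_set; apply: (cA t%:num x y).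
Qed.

Lemma hull_min A B : is_convex B -> A `<=` B -> hull A `<=` B.
Proof. by move=> /convex_setE cB; apply: smallest_sub. Qed.

Lemma sub_hull A : A `<=` hull A. Proof. exact: sub_gen_smallest. Qed.

Lemma hull_convex A : is_convex (hull A).
Proof.
move=> t x y t0 t1 hx hy B [cB AB]; move/convex_setE: (cB) => cB'.
by apply: cB' => //; [apply: hx|apply: hy].
Qed.

Lemma convex_halfspace a k : is_convex [set x | dot a x <= k].
Proof. by move=> t x y t0 t1 /= hx hy; rewrite dot_mix; nra. Qed.

Lemma convexI A B : is_convex A -> is_convex B -> is_convex (A `&` B).
Proof. by move=> cA cB t x y t0 t1 [? ?] [? ?]; split; [apply: cA|apply: cB]. Qed.

Lemma convex_plane a k : is_convex [set x | dot a x = k].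
Proof. by move=> t x y t0 t1 /= hx hy; rewrite dot_mix hx hy; ring. Qed.

Lemma segmentP p q x :
  segment p q x <-> exists2 t, 0 <= t <= 1 & x = mix t p q.
Proof.
split=> [|[t /andP[t0 t1] ->]]; last first.
  by apply: hull_convex => //; apply: sub_hull; [left|right].
apply: (hull_min (B := [set x | exists2 t, 0 <= t <= 1 & x = mix t p q])).
  move=> k y z k0 k1 /= [t /andP[t0 t1] ->] [s /andP[s0 s1] ->].
  exists (k * t + (1 - k) * s); first by apply/andP; split; nra.
  by apply: eq_coord; rewrite /mix !coordE; ring.
move=> _ [->|->]; [exists 1|exists 0]; rewrite ?lexx ?ler01 //.
  by apply: eq_coord; rewrite /mix !coordE; ring.
by apply: eq_coord; rewrite /mix !coordE; ring.
Qed.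

Lemma segmentl p q : segment p q p. Proof. by apply: sub_hull; left. Qed.
Lemma segmentr p q : segment p q q. Proof. by apply: sub_hull; right. Qed.
Lemma segmentC p q : segment p q = segment q p.
Proof. by rewrite /segment setUC. Qed.
Lemma segment_sub A p q : is_convex A -> A p -> A q -> segment p q `<=` A.
Proof. by move=> cA Ap Aq; apply: hull_min => // _ [->|->]. Qed.
Lemma segmentxx p : segment p p = [set p].
Proof.
apply/seteqP; split=> [x /segmentP[t _ ->]|x ->]; last exact: segmentl.
by rewrite /=; apply: eq_coord; rewrite /mix !coordE; ring.
Qed.
End Vectors.
Arguments segmentl {R} p q.
Arguments segmentr {R} p q.

(** * Sets of dimension at most three *)

Section Dimension.
Context {R : realType}.
Local Notation V := 'rV[R]_3.
Implicit Types (a c m n p q v w x y z : V) (k l s t b d : R) (A B S P : set V).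

Lemma mixE t x y : mix t x y = y + t *: (x - y).
Proof. by apply: eq_coord; rewrite /mix !coordE; ring. Qed.

Lemma mix1 x y : mix 1 x y = x.
Proof. by apply: eq_coord; rewrite /mix !coordE; ring. Qed.

Lemma mix0 x y : mix 0 x y = y.
Proof. by apply: eq_coord; rewrite /mix !coordE; ring. Qed.

Lemma mixC t x y : mix t x y = mix (1 - t) y x.
Proof. by apply: eq_coord; rewrite /mix !coordE; ring. Qed.

Lemma mixBr t x y : mix t x y - y = t *: (x - y).
Proof. by rewrite mixE addrC addKr. Qed.

Lemma mix_inj x y s t : x != y -> mix s x y = mix t x y -> s = t.
Proof.
rewrite -subr_eq0 !mixE => xy /addrI /eqP.
by rewrite -subr_eq0 -scalerBl scaler_eq0 (negPf xy) orbF subr_eq0 => /eqP.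
Qed.

Lemma has_dim0 x : has_dim 0 [set x].
Proof.
exists x => //; exists 0; split; first by rewrite /row_free mxrank0.
  by case.
by move=> _ ->; rewrite subrr sub0mx.
Qed.

Lemma has_dim1E S : has_dim 1 S -> exists x y, [/\ S x, S y & x != y].
Proof.
case=> x Sx [M [Mf SM _]]; exists x, (x + row 0 M); split=> //.
move: Mf; rewrite -[in row_free M](row_id 0 M) /row_free rank_rV eqb1.
by apply: contraNneq => /eqP; rewrite -subr_eq0 opprD addrA subrr sub0r oppr_eq0.
Qed.

Lemma has_dim1_line S x y z : has_dim 1 S -> S x -> S y -> S z -> x != y ->
  exists k, z = mix k y x.
Proof.
case=> o So [M [_ _ SM]] Sx Sy Sz xy.
have line u : S u -> exists k, u = o + k *: M.
  by move/SM/sub_rVP => [k e]; exists k; rewrite -e [RHS]addrC subrK.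
have [kx ex] := line _ Sx; have [ky ey] := line _ Sy; have [kz ez] := line _ Sz.
have kxy : ky - kx != 0.
  by rewrite subr_eq0; apply: contra_neq xy => e; rewrite ex ey e.
exists ((kz - kx) / (ky - kx)); rewrite mixE ez ey ex.
have -> : o + ky *: M - (o + kx *: M) = (ky - kx) *: M.
  by apply: eq_coord; rewrite !coordE; ring.
by rewrite scalerA divfK // -addrA -scalerDl [kx + _]addrC subrK.
Qed.

Lemma has_dim1I S x y : S x -> S y -> x != y ->
  (forall z, S z -> exists k, z = mix k y x) -> has_dim 1 S.
Proof.
move=> Sx Sy xy SL; exists x => //; exists (y - x); split.
- by rewrite /row_free rank_rV subr_eq0 [y == x]eq_sym xy.
- by move=> i; rewrite (ord1 i) row_id addrC subrK.
- by move=> z /SL[k ->]; rewrite mixBr scalemx_sub.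
Qed.

(* The row vector with entries [k] and [l]. *)
Let row2 (k l : R) : 'rV[R]_2 := \row_j [:: k; l]`_j.
Let row2M k l (M : 'M[R]_(2, 3)) :
  row2 k l *m M = k *: row 0 M + l *: row 1 M.
Proof.
rewrite mulmx_sum_row !big_ord_recr big_ord0 /= add0r !mxE /=.
by congr (k *: row _ M + l *: row _ M); apply/val_inj.
Qed.
Let row2E (u : 'rV[R]_2) : u = row2 (u 0 0) (u 0 1).
Proof.
apply/rowP => -[[|[|//]] i]; rewrite mxE /=.
  by congr (u _ _); apply/val_inj.
by congr (u _ _); apply/val_inj.
Qed.

Lemma has_dim2I S a b x y z : a != 0 -> (forall u, S u -> dot a u = b) ->
  S x -> S y -> S z -> triple a (y - x) (z - x) != 0 -> has_dim 2 S.
Proof.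
move=> a0 Sab Sx Sy Sz t0; exists x => //.
pose M : 'M[R]_(2, 3) := \matrix_(i < 2) [:: y - x; z - x]`_i.
have M0 : row 0 M = y - x by rewrite rowK.
have M1 : row 1 M = z - x by rewrite rowK.
exists M; split.
- apply: inj_row_free => u; rewrite [u]row2E row2M M0 M1.
  set k := u 0 0; set l := u 0 1 => e.
  have k0 : k = 0.
    have := congr1 (triple a (z - x)) e.
    rewrite tripleDr !tripleZr triplexx triple_swap mulr0 addr0.
    rewrite [X in _ = X]tripleE !coordE !mulr0 !subrr !mulr0 !subrr addr0.
    by move/eqP; rewrite mulrN oppr_eq0 mulf_eq0 (negPf t0) orbF => /eqP.
  have l0 : l = 0.
    have := congr1 (triple a (y - x)) e.
    rewrite tripleDr !tripleZr triplexx mulr0 add0r.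
    rewrite [X in _ = X]tripleE !coordE !mulr0 !subrr !mulr0 !subrr addr0.
    by move/eqP; rewrite mulf_eq0 (negPf t0) orbF => /eqP.
  by rewrite k0 l0; apply/rowP => -[[|[|//]] i]; rewrite !mxE.
- move=> -[[|[|//]] i]; rewrite rowK /= addrC subrK //.
- move=> u Su; have [||||k [l ->]] := @triple_span _ a (y - x) (z - x) (u - x) a0;
    rewrite ?dotBr ?(Sab _ Su) ?(Sab _ Sx) ?(Sab _ Sy) ?(Sab _ Sz) ?subrr //.
  by rewrite -M0 -M1 addmx_sub // scalemx_sub // row_sub.
Qed.

(** From any point [v] of a plane set of dimension two, two independent
    directions lead to other points of the set. *)
Lemma has_dim2E S a b v : a != 0 -> (forall u, S u -> dot a u = b) ->
  has_dim 2 S -> S v ->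
  exists x y, [/\ S x, S y & triple a (x - v) (y - v) != 0].
Proof.
move=> a0 Sab [o So [M [Mf SM _]]] Sv.
have Minj (u : 'rV_2) : u *m M = 0 -> u = 0.
  by move=> e; apply: (row_free_inj Mf); rewrite /= mul0mx.
set m := row 0 M; set n := row 1 M.
have am : dot a m = 0.
  by have := Sab _ (SM 0); rewrite dotDr (Sab _ So) -/m; lra.
have an : dot a n = 0.
  by have := Sab _ (SM 1); rewrite dotDr (Sab _ So) -/n; lra.
have m0 : m != 0.
  apply/eqP => m0; have e : row2 1 0 = 0.
    by apply: Minj; rewrite row2M -/m -/n m0 scaler0 scale0r addr0.
  by have := congr1 (fun u : 'rV_2 => u 0 0) e; rewrite !mxE /= => /eqP; rewrite oner_eq0.
have t0 : triple a m n != 0.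
  apply/eqP => /(triple_eq0 a0 m0 am an)[k nE].
  have e : row2 (- k) 1 = 0.
    by apply: Minj; rewrite row2M -/m -/n nE scaleNr scale1r addNr.
  by have := congr1 (fun u : 'rV_2 => u 0 1) e; rewrite !mxE /= => /eqP; rewrite oner_eq0.
(* The area of a triangle is the sum of the oriented areas seen from [v]. *)
have area : triple a m n = triple a (o + m - v) (o + n - v)
   + triple a (o + n - v) (o - v) + triple a (o - v) (o + m - v).
  by rewrite !tripleE !coordE; ring.
have [h1|h1] := eqVneq (triple a (o + m - v) (o + n - v)) 0; last first.
  by exists (o + m), (o + n); split=> //; apply: SM.
have [h2|h2] := eqVneq (triple a (o + n - v) (o - v)) 0; last first.
  by exists (o + n), o; split=> //; apply: SM.
have [h3|h3] := eqVneq (triple a (o - v) (o + m - v)) 0; last first.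
  by exists o, (o + m); split=> //; apply: SM.
by move: t0; rewrite area h1 h2 h3 !addr0 eqxx.
Qed.

Lemma has_dim3E S a b : a != 0 -> has_dim 3 S ->
  exists2 x, S x & dot a x != b.
Proof.
move=> a0 [o So [M [Mf SM _]]]; apply: contrapT => h.
have Sab u : S u -> dot a u = b.
  by move=> Su; apply: contrapT => /eqP ne; apply: h; exists u.
case/negP: a0; rewrite -trmx_eq0; move: Mf; rewrite row_free_unit => Mu.
rewrite -(mulKmx Mu a^T) (_ : M *m a^T = 0) ?mulmx0 //.
apply/colP => i; rewrite mxE [RHS]mxE.
have := Sab _ (SM i); rewrite dotDr (Sab _ So) => e.
have rM0 : dot (row i M) a = 0 by rewrite dotC; lra.
by rewrite -[RHS]rM0 /dot mxE; apply: eq_bigr => j _; rewrite !mxE.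
Qed.

(** A two-dimensional face has only one outward direction. *)
Lemma facet_normal P S a c : has_dim 3 P -> has_dim 2 S ->
  outward_normal P S a -> outward_normal P S c ->
  exists2 k, 0 < k & a = k *: c.
Proof.
move=> P3 S2 [a0 [b Pb SE]] [c0 [d Pd SE']].
have Sb u : S u -> dot a u = b by rewrite SE => -[].
have Sd u : S u -> dot c u = d by rewrite SE' => -[].
have [o So] : exists o, S o by case: S2 => o So _; exists o.
have [x [y [Sx Sy t0]]] := has_dim2E a0 Sb S2 So.
have cc := dotxx_gt0 c0; pose k := dot c a / dot c c.
have aE : a = k *: c.
  have w0 : dot c (a - k *: c) = 0 by rewrite dotBr dotZr /k divfK ?subrr // lt0r_neq0.
  have cx : dot c (x - o) = 0 by rewrite dotBr !Sd // subrr.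
  have cy : dot c (y - o) = 0 by rewrite dotBr !Sd // subrr.
  have tc : triple c (x - o) (y - o) != 0.
    have xo0 : x - o != 0 by exact: triple_neq0 t0.
    apply/eqP => /(triple_eq0 c0 xo0 cx cy)[l yE].
    by move: t0; rewrite yE tripleZr triplexx mulr0 eqxx.
  have [l [l' e]] := triple_span c0 cx cy tc w0.
  suff: dot (a - k *: c) (a - k *: c) = 0.
    by move/dotxx_eq0/eqP; rewrite subr_eq0 => /eqP.
  have wx u : S u -> dot (a - k *: c) (u - o) = 0.
    move=> Su; rewrite dotDl dotNl dotZl !dotBr !Sb // !Sd //; ring.
  by rewrite {2}e dotDr !dotZr !wx // !mulr0 addr0.
have [u Pu ub] := has_dim3E b a0 P3.
exists k => //.
have := Pb _ Pu; rewrite le_eqVlt (negPf ub) /= => ltb.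
have /= := Pd _ Pu; have := Sb _ So; have := Sd _ So.
move: ltb; rewrite aE !dotZl; nra.
Qed.

(** A segment determines its endpoints. *)
Lemma segment_inj p q x y : segment p q = segment x y ->
  (p = x /\ q = y) \/ (p = y /\ q = x).
Proof.
move=> e.
have /segmentP[s /andP[s0 s1] ep] : segment x y p by rewrite -e; apply: segmentl.
have /segmentP[t /andP[t0 t1] eq] : segment x y q by rewrite -e; apply: segmentr.
have /segmentP[k /andP[k0 k1] ex] : segment p q x by rewrite e; apply: segmentl.
have /segmentP[l /andP[l0 l1] ey] : segment p q y by rewrite e; apply: segmentr.
have [xy|xy] := eqVneq x y.
  by left; rewrite ep eq xy; split; apply: eq_coord; rewrite /mix !coordE; ring.
have mm u : mix u p q = mix (u * s + (1 - u) * t) x y.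
  by rewrite ep eq; apply: eq_coord; rewrite /mix !coordE; ring.
have h1 : 1 = k * s + (1 - k) * t by apply: (mix_inj xy); rewrite -mm -ex mix1.
have h0 : 0 = l * s + (1 - l) * t by apply: (mix_inj xy); rewrite -mm -ey mix0.
have [s1'|s1'] := eqVneq s 1.
  left; split; first by rewrite ep s1' mix1.
  by rewrite eq (_ : t = 0) ?mix0 //; nra.
have t1' : t = 1.
  have : s < 1 by rewrite lt_neqAle s1' s1.
  have [k00|k0'] := eqVneq k 0; first by move: h1; rewrite k00; lra.
  have : 0 < k by rewrite lt_neqAle eq_sym k0' k0.
  by nra.
right; split; last by rewrite eq t1' mix1.
by rewrite ep (_ : s = 0) ?mix0 //; nra.
Qed.

End Dimension.

(** * Faces of polytopes *)

Lemma seq_max (R : realDomainType) (T : eqType) (f : T -> R) (s : seq T) (x0 : T) : x0 \in s ->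
  exists2 x, x \in s & forall y, y \in s -> f y <= f x.
Proof.
elim: s x0 => // x s IH x0 _; case: s => [|y s] in IH *.
  by exists x; rewrite ?mem_head // => y; rewrite inE => /eqP ->.
have [z zs zm] := IH y (mem_head _ _).
have [xz|zx] := leP (f x) (f z).
  exists z => [|u]; first by rewrite inE zs orbT.
  by rewrite inE => /predU1P[->|/zm].
exists x => [|u]; first by rewrite mem_head.
by rewrite inE => /predU1P[->|/zm/le_trans->] //; apply: ltW.
Qed.

Section Polytopes.
Context {R : realType}.
Local Notation V := 'rV[R]_3.
Implicit Types (a c h m n p q u v w x y z : V) (k l s t b d : R)
  (A B D E F G P Q S : set V).

Lemma finite_max A (f : V -> R) x0 : finite_set A -> A x0 ->
  exists2 x, A x & forall y, A y -> f y <= f x.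
Proof.
move=> /finite_seqP[s ->] /= x0s; have [x xs xm] := seq_max f x0s.
by exists x.
Qed.

(** The closed half-space [dot a x <= b] contains [P] and its boundary plane
    meets [P] in [S]. *)
Definition exposes P a b S : Prop :=
  (forall x, P x -> dot a x <= b) /\ S = P `&` [set x | dot a x = b].

Lemma outward_normalP P S a :
  outward_normal P S a <-> a != 0 /\ exists b, exposes P a b S.
Proof.
by split=> -[a0] => [[b h ->]|[b [h ->]]]; split=> //; exists b.
Qed.

Lemma exposes_convex P a b S : is_convex P -> exposes P a b S -> is_convex S.
Proof. by move=> cP [_ ->]; apply: convexI => //; apply: convex_plane. Qed.

(** A supporting functional attaining its maximum inside a segment of the body
    is constant on it. *)
Lemma exposes_absorb P a b S t x y : exposes P a b S -> P x -> P y ->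
  0 < t -> t < 1 -> S (mix t x y) -> S x /\ S y.
Proof.
move=> [Pb ->] Px Py t0 t1 [_ /=]; rewrite dot_mix => e.
by have := Pb _ Px; have := Pb _ Py; split; split=> //=; nra.
Qed.

(** A face of a face of a polytope is a face: if [h] is a functional that is
    only required to be bounded on the face exposed by [a], then [N a + h]
    exposes the same subface of the whole polytope when [N] is large, because
    only finitely many generators have to be checked. *)
Lemma face_of_face Q G a h k : (exists2 A, finite_set A & Q = hull A) ->
  outward_normal Q G a -> (forall x, G x -> dot h x <= k) ->
  exists h', outward_normal Q (G `&` [set x | dot h x = k]) h'.
Proof.
move=> [A finA QA] /outward_normalP[a0 [b [Qb GE]]] Gk.
have AQ x : A x -> Q x by move=> Ax; rewrite QA; apply: sub_hull.
pose f x := (dot h x - k) / (b - dot a x).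
have [M MA] : exists M, forall x, A x -> f x <= M.
  have [[x Ax]|A0] := pselect (exists x, A x).
    by have [y _ ym] := finite_max f finA Ax; exists (f y).
  by exists 0 => x Ax; case: A0; exists x.
have expN N : M < N ->
    exposes Q (N *: a + h) (N * b + k) (G `&` [set x | dot h x = k]).
  move=> MN.
  pose W := [set x | Q x /\ (dot (N *: a + h) x <= N * b + k /\
     (dot (N *: a + h) x = N * b + k -> dot a x = b))].
  have QW : Q `<=` W.
    rewrite {1}QA; apply: hull_min.
      move=> t x y t0 t1 [Qx [hx ex]] [Qy [hy ey]]; split; last split.
      - by rewrite QA in Qx Qy *; apply: hull_convex.
      - by rewrite dot_mix; nra.
      - have [->|tn0] := eqVneq t 0; first by rewrite mix0.
        have [->|tn1] := eqVneq t 1; first by rewrite mix1.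
        have t0' : 0 < t by rewrite lt_neqAle eq_sym tn0.
        have t1' : t < 1 by rewrite lt_neqAle tn1.
        rewrite !dot_mix => e.
        have xe : dot (N *: a + h) x = N * b + k by nra.
        have ye : dot (N *: a + h) y = N * b + k by nra.
        by rewrite (ex xe) (ey ye); ring.
    move=> x Ax; have Qx := AQ _ Ax; split=> //.
    have := Qb _ Qx; rewrite le_eqVlt => /orP[/eqP axb|axb].
      have Gx : G x by rewrite GE.
      by have := Gk _ Gx; rewrite dotDl dotZl axb lerD2l.
    have bax : 0 < b - dot a x by rewrite subr_gt0.
    have lt : dot (N *: a + h) x < N * b + k.
      have := le_lt_trans (MA _ Ax) MN; rewrite /f ltr_pdivrMr // dotDl dotZl.
      by lra.
    by split; [exact: ltW|move=> e; rewrite e ltxx in lt].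
  split; first by move=> x /QW[_ []].
  apply/seteqP; split=> x /=.
    by rewrite GE => -[[Qx /= ax] hx]; split=> //; rewrite dotDl dotZl ax hx.
  case=> Qx e; have [_ [_ /(_ e) ax]] := QW _ Qx; split; first by rewrite GE.
  by move: e; rewrite dotDl dotZl ax; lra.
(* At least one of the two multipliers yields a nonzero functional. *)
have [h0|h0] := eqVneq ((M + 1) *: a + h) 0.
  exists ((M + 2) *: a + h); apply/outward_normalP; split.
    have -> : (M + 2) *: a + h = a + ((M + 1) *: a + h).
      by apply: eq_coord; rewrite !coordE; ring.
    by rewrite h0 addr0.
  by exists ((M + 2) * b + k); apply: expN; lra.
exists ((M + 1) *: a + h); apply/outward_normalP; split=> //.
by exists ((M + 1) * b + k); apply: expN; lra.
Qed.

(** An edge containing two points of another edge contains it. *)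
Lemma edge_sub P E D x y : edge P E -> edge P D -> E x -> E y -> D x -> D y ->
  x != y -> D `<=` E.
Proof.
move=> [[a /outward_normalP[_ [b [Pb EE]]]] _] [[h /outward_normalP[_ [k [_ DE]]]] D1].
move=> Ex Ey Dx Dy xy z Dz; have [l zE] := has_dim1_line D1 Dx Dy Dz xy.
move: Ex Ey; rewrite EE => -[Px /= ax] [Py /= ay].
split; first by move: Dz; rewrite DE => -[].
by rewrite /= zE dot_mix ax ay; ring.
Qed.

Lemma edge_eq P E D x y : edge P E -> edge P D -> E x -> E y -> D x -> D y ->
  x != y -> E = D.
Proof.
move=> eE eD Ex Ey Dx Dy xy; apply/seteqP; split.
  exact: (edge_sub eD eE Dx Dy Ex Ey xy).
exact: (edge_sub eE eD Ex Ey Dx Dy xy).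
Qed.

Lemma segment_edge_neq P p q : edge P (segment p q) -> p != q.
Proof.
move=> [_ /has_dim1E[x [y [Sx Sy]]]]; apply: contra_neq => e.
by move: Sx Sy; rewrite e segmentxx => -> ->.
Qed.
End Polytopes.

(** * Cyclic sequences *)

Section Cycles.
Context {T : eqType}.
Implicit Types (s t : seq T) (x y z p q : T).

Lemma next_inj s : uniq s -> injective (next s).
Proof. by move=> us; apply: can_inj (prev_next us). Qed.

(** The successor of [y] in the cycle [s] once [p] has been removed from it. *)
Definition skip s p y := if next s y == p then next s p else next s y.

Lemma skip_cycle s p : uniq s -> p \in s ->
  fcycle (skip s p) [seq y <- s | y != p].
Proof.
move=> us ps; have := cycle_next us; move: (ps) (us).
have: skip s p =1 (fun y => if next s y == p then next s p else next s y) by [].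
move: (next s) => g; move: (skip s p) => f fE.
case/splitPr: ps => s1 s2 _; rewrite uniq_catC /= mem_cat negb_or.
case/andP=> /andP[ps2 ps1] _.
have -> : [seq y <- s1 ++ p :: s2 | y != p] = s1 ++ s2.
  rewrite filter_cat /= eqxx /=; congr (_ ++ _); apply/all_filterP/allP => y ys.
    by apply: contraNneq ps1 => <-.
  by apply: contraNneq ps2 => <-.
rewrite -(rot_cycle (size s1)) rot_size_cat -(rot_cycle (size s1) _ (s1 ++ s2)).
rewrite rot_size_cat /=.
have : p \notin s2 ++ s1 by rewrite mem_cat negb_or ps1 ps2.
case: (s2 ++ s1) => //= q t; rewrite inE negb_or => /andP[_] pt /andP[/eqP gp].
have {pt} : p \notin t by [].
elim: t {1 2}q => [|y t IH] x /=.
  by rewrite !andbT fE => _ /eqP ->; rewrite eqxx gp.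
rewrite inE negb_or => /andP[py pt] /andP[/eqP gx gt].
by rewrite fE gx [y == p]eq_sym (negPf py) eqxx IH.
Qed.

Lemma next_skip s p y : uniq s -> p \in s -> y \in s -> y != p ->
  next [seq z <- s | z != p] y = skip s p y.
Proof.
move=> us ps ys yp; apply/esym/eqP.
by apply: (next_cycle (skip_cycle us ps)); rewrite mem_filter yp.
Qed.

Lemma next_map_in (T' : eqType) (h : T -> T') s x :
  uniq s -> {in s &, injective h} -> x \in s -> next (map h s) (h x) = h (next s x).
Proof.
move=> us hI xs; pose e a b := has (fun y => (h y == a) && (h (next s y) == b)) s.
have: cycle e (map h s).
  rewrite cycle_map; apply: (sub_in_cycle (P := mem s)) (cycle_next us); last exact/allP.
  by move=> y z ys _ /eqP /= <-; apply/hasP; exists y; rewrite ?eqxx.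
move/next_cycle => /(_ (h x) (map_f h xs)) /hasP[y ys /andP[/eqP /hI yx /eqP <-]].
by rewrite yx.
Qed.

(** In a sorted cycle the labels increase, except from the last element to the
    first, which carry the largest and the smallest label. *)
Lemma next_sorted s (g : T -> int) x : uniq s -> sorted <%R (map g s) -> x \in s ->
  g x < g (next s x) \/ forall z, z \in s -> g (next s x) <= g z <= g x.
Proof.
case: s => // h t us sg xs; rewrite next_nth xs.
set s := h :: t in us sg xs *; set i := index x s.
have is_ : (i < size s)%N by rewrite index_mem.
have gnth j k : (j < k)%N -> (k < size s)%N -> g (nth h s j) < g (nth h s k).
  move=> jk ks; rewrite -!(nth_map h (g h) g) // ?(ltn_trans jk) //.
  by apply: (sorted_ltn_nth lt_trans) => //; rewrite inE size_map ?(ltn_trans jk).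
have gle j k : (j <= k)%N -> (k < size s)%N -> g (nth h s j) <= g (nth h s k).
  by rewrite leq_eqVlt => /predU1P[->//|jk] ks; apply/ltW/gnth.
have [lt|ge] := ltnP i.+1 (size s).
  left; rewrite -{1}(nth_index h xs) -/i (_ : nth h t i = nth h s i.+1) //.
  exact: gnth.
(* Past the end of the list, [next] returns its head by default. *)
right=> z zs; rewrite nth_default //.
have -> : x = nth h s i by rewrite nth_index.
have -> : z = nth h s (index z s) by rewrite nth_index.
have zi : (index z s <= i)%N by rewrite -ltnS (leq_trans _ ge) // index_mem.
by rewrite gle // andbT (gle 0%N) // index_mem.
Qed.

(** The cyclic order: [a], [b], [c] are increasing up to rotation. *)
Definition cyc (a b c : int) := [|| a < b < c, b < c < a | c < a < b].

Lemma next_cyc s (g : T -> int) x : uniq s -> sorted <%R (map g s) -> x \in s ->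
  next s (next s x) != x -> cyc (g x) (g (next s x)) (g (next s (next s x))).
Proof.
move=> us sg xs; set y := next s x; set z := next s y => zx.
have ys : y \in s by rewrite mem_next.
have zs : z \in s by rewrite mem_next.
have gI : {in s &, injective g}.
  have : uniq (map g s) by apply: sorted_uniq sg; [exact: lt_trans|exact: ltxx].
  move=> ug u w us' ws e; have := nth_index u us'; have := nth_index u ws.
  have : index u s = index w s.
    apply/eqP; rewrite -(nth_uniq (g u) _ _ ug) ?size_map ?index_mem //.
    by rewrite !(nth_map u) ?index_mem // !nth_index // e.
  by move=> -> -> .
have gzx : g z != g x by apply: contra_neq zx; apply: gI.
rewrite /cyc; have [xy|hx] := next_sorted us sg xs; have [yz|hy] := next_sorted us sg ys.
- by rewrite xy yz.
- have /andP[zx' _] := hy _ xs.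
  by rewrite -/y in xy; rewrite xy [g z < g x]lt_neqAle gzx zx' !orbT.
- have /andP[_ zx'] := hx _ zs.
  by rewrite -/z in yz; rewrite yz [g z < g x]lt_neqAle gzx zx' !orbT.
- have /andP[_ h1] := hy _ xs; have /andP[h2 _] := hx _ xs.
  have xy : x = y by apply: gI => //; apply/eqP; rewrite eq_le h1 h2.
  by case/eqP: zx; rewrite /z -xy.
Qed.

Lemma cyc_between (a b c : int) : a < c -> cyc a b c -> a < b < c.
Proof.
move=> ac /or3P[//|/andP[_ /(lt_trans ac)]|/andP[/(lt_trans ac)]];
  by rewrite ltxx.
Qed.

Lemma cyc_outside (a b c : int) : c <= a -> cyc a b c -> a < b \/ b < c.
Proof.
move=> ca /or3P[/andP[]|/andP[]|/andP[_]]; last by left.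
  by left.
by right.
Qed.
End Cycles.

(** * Attaching the pyramid *)

(** Two planes with normals [a] and [c] meet along [m].  If [c] decreases on the
    first plane towards [Y], and [a] decreases on the second one towards [X], then
    [X] and [Y] lie on opposite sides of [m] as seen from outside. *)
Lemma opposite_turns (R : realType) (a c m X Y : 'rV[R]_3) :
  a != 0 -> c != 0 -> m != 0 -> dot a m = 0 -> dot c m = 0 ->
  dot c X = 0 -> dot a X < 0 -> dot a Y = 0 -> dot c Y < 0 ->
  0 <= triple c m X -> 0 <= triple a m Y -> False.
Proof.
move=> /dotxx_gt0 aa /dotxx_gt0 cc /dotxx_gt0 mm am cm cX aX aY cY tX tY.
have rot x y z : triple x y z = triple y z x :> R by rewrite !tripleE; ring.
have g1 : triple a c m * triple c m X = dot a X * (dot c c * dot m m).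
  rewrite -rot triple_gram [dot m c]dotC am cm cX; ring.
have g2 : - triple a c m * triple a m Y = dot c Y * (dot a a * dot m m).
  have -> : - triple a c m = triple c a m by rewrite !tripleE; ring.
  by rewrite -[triple a m Y]rot triple_gram [dot m a]dotC am cm aY; ring.
have n1 : dot a X * (dot c c * dot m m) < 0 by rewrite nmulr_rlt0 // mulr_gt0.
have n2 : dot c Y * (dot a a * dot m m) < 0 by rewrite nmulr_rlt0 // mulr_gt0.
rewrite -g1 in n1; rewrite -g2 in n2.
have [le|gt] := lerP 0 (triple a c m).
  by move: n1; rewrite ltNge mulr_ge0.
by move: n2; rewrite ltNge mulr_ge0 // oppr_ge0 ltW.
Qed.

Lemma has_dim2_not_segment (R : realType) (S : set 'rV[R]_3) a b p q :
  a != 0 -> (forall x, S x -> dot a x = b) -> has_dim 2 S -> S p ->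
  ~ S `<=` segment p q.
Proof.
move=> a0 Sb S2 Sp SE; have [x [y [Sx Sy t0]]] := has_dim2E a0 Sb S2 Sp.
have par z : S z -> exists k, z - p = k *: (q - p).
  move=> /SE/segmentP[t _ ->]; exists (1 - t).
  by apply: eq_coord; rewrite /mix !coordE; ring.
have [k xE] := par _ Sx; have [l yE] := par _ Sy.
by move: t0; rewrite xE yE tripleZl tripleZr triplexx !mulr0 eqxx.
Qed.

Section Cap.
Context {R : realType}.
Local Notation V := 'rV[R]_3.
Implicit Types (a h m n p q u w x y z e f s : V) (k l t b : R)
  (A B D E G S : set V).
(** [F] is a facet of [P], in the plane [dot c x = d]; the apex [v] lies beyond this
    plane, and no edge and no vertex of [F] survives in [Q]. *)
Context (P Q F : set V) (v c : V) (d : R).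
Context (polyP : exists2 A, finite_set A & P = hull A).
Context (polyQ : exists2 A, finite_set A & Q = hull A).
Context (F0 : exists f, F f) (exF : exposes P c d F) (cv : d < dot c v).
Context (QE : Q = P `|` pyramid F v).
Context (P3 : has_dim 3 P) (Q3 : has_dim 3 Q) (F2 : has_dim 2 F).
Context (noE : forall E, edge P E -> E `<=` F -> ~ edge Q E).
Context (noV : forall u, vertex P u -> F u -> ~ vertex Q u).

Lemma polytope_convex S : (exists2 A, finite_set A & S = hull A) -> is_convex S.
Proof. by move=> [A _ ->]; apply: hull_convex. Qed.

Let Qcv : is_convex Q := polytope_convex polyQ.

Let Fcv : is_convex F. Proof. exact: exposes_convex (polytope_convex polyP) exF. Qed.
Let Pd x : P x -> dot c x <= d. Proof. by case: exF => + _; apply. Qed.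
Let FP x : F x -> P x. Proof. by case: exF => _ ->; case. Qed.
Let Fd x : F x -> dot c x = d. Proof. by case: exF => _ ->; case. Qed.
Let FI x : P x -> dot c x = d -> F x. Proof. by case: exF => _ -> //. Qed.
Let ltd x : P x -> ~ F x -> dot c x < d.
Proof.
move=> Px nFx; rewrite lt_neqAle Pd // andbT; apply/eqP => e; exact/nFx/FI.
Qed.
Let PQ x : P x -> Q x. Proof. by rewrite QE; left. Qed.

Lemma apex_notin : ~ P v.
Proof. by move/Pd; rewrite leNgt cv. Qed.

Lemma pyramidP x :
  pyramid F v x <-> exists2 f, F f & exists2 t, 0 <= t <= 1 & x = mix t v f.
Proof.
have [f0 Ff0] := F0; split.
  apply: (hull_min (B := [set x | exists2 f, F f &
    exists2 t, 0 <= t <= 1 & x = mix t v f])).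
    move=> t y z t0 t1 /= [f Ff [k /andP[k0 k1] ->]] [g Fg [l /andP[l0 l1] ->]].
    set m := t * (1 - k); set n := (1 - t) * (1 - l).
    have m0 : 0 <= m by apply: mulr_ge0 => //; lra.
    have n0 : 0 <= n by apply: mulr_ge0; lra.
    have mn1 : m + n <= 1.
      have p1 : 0 <= t * k by apply: mulr_ge0.
      have p2 : 0 <= (1 - t) * l by apply: mulr_ge0 => //; lra.
      by rewrite /m /n; lra.
    have -> : mix t (mix k v f) (mix l v g) = v + m *: (f - v) + n *: (g - v).
      by apply: eq_coord; rewrite /mix /m /n !coordE; ring.
    move: m n m0 n0 mn1 => m n m0 n0 mn1.
    have [mn0|mn0] := eqVneq (m + n) 0.
      have [-> ->] : m = 0 /\ n = 0 by split; lra.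
      exists f => //; exists 1; rewrite ?ler01 ?lexx //.
      by rewrite mix1 !scale0r !addr0.
    have mn_gt0 : 0 < m + n by rewrite lt_neqAle eq_sym mn0 addr_ge0.
    exists (mix (m / (m + n)) f g).
      apply: Fcv => //; first by rewrite divr_ge0 // ltW.
      by rewrite ler_pdivrMr // mul1r lerDl.
    exists (1 - (m + n)); first by apply/andP; split; lra.
    by apply: eq_coord; rewrite /mix !coordE; field.
  move=> z [->|Fz].
    by exists f0 => //; exists 1; rewrite ?mix1 // ler01 lexx.
  by exists z => //; exists 0; rewrite ?mix0 // ler01 lexx.
move=> [f Ff [t /andP[t0 t1] ->]]; apply: hull_convex => //; apply: sub_hull.
  by left.
by right.
Qed.

Lemma cap_sub x : Q x -> ~ P x ->
  exists2 f, F f & exists2 t, 0 < t <= 1 & x = mix t v f.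
Proof.
rewrite QE => -[//|/pyramidP[f Ff [t /andP[t0 t1] ->]]] nP.
exists f => //; exists t => //; rewrite t1 andbT lt_neqAle t0 andbT eq_sym.
by apply/eqP => e; apply: nP; rewrite e mix0; apply: FP.
Qed.

Lemma cap_mix f t : F f -> 0 <= t -> t <= 1 -> Q (mix t v f).
Proof.
move=> Ff t0 t1; rewrite QE; right; apply/pyramidP; exists f => //.
by exists t => //; rewrite t0 t1.
Qed.

Lemma apex_in : Q v.
Proof. by have [f Ff] := F0; rewrite -(mix1 v f); apply: cap_mix; rewrite ?ler01. Qed.

Lemma dot_cap t f : F f -> dot c (mix t v f) = d + t * (dot c v - d).
Proof. by move=> /Fd fd; rewrite dot_mix fd; ring. Qed.

(** The plane of the base meets [Q] in the base only. *)
Lemma base_cut x : Q x -> dot c x = d -> F x.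
Proof.
move=> Qx xd; have [Px|/(cap_sub Qx)[f Ff [t /andP[t0 _] xE]]] := pselect (P x).
  exact: FI.
by exfalso; move: xd; rewrite xE dot_cap //; have := cv; nra.
Qed.

Lemma cap_ge x : Q x -> ~ P x -> d < dot c x.
Proof.
move=> Qx /(cap_sub Qx)[f Ff [t /andP[t0 _] ->]].
by rewrite dot_cap // ltrDl mulr_gt0 // subr_gt0.
Qed.

(** The segment from a point of [P] to the apex crosses the base. *)
Lemma cross s : P s -> exists t, [/\ 0 <= t, t < 1 & F (mix t v s)].
Proof.
move=> Ps; have sd := Pd Ps; pose t := (d - dot c s) / (dot c v - dot c s).
have vs : 0 < dot c v - dot c s by have := cv; lra.
have t0 : 0 <= t by apply: divr_ge0; rewrite ?subr_ge0 // ltW // -subr_gt0.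
have t1 : t < 1 by rewrite ltr_pdivrMr // mul1r; have := cv; lra.
exists t; split=> //; apply: base_cut.
  by apply: Qcv => //; [exact: ltW|exact: apex_in|exact: PQ].
have tE : t * (dot c v - dot c s) = d - dot c s by rewrite /t divfK // lt0r_neq0.
by rewrite dot_mix; nra.
Qed.

Lemma cross_gt0 s t : ~ F s -> 0 <= t -> F (mix t v s) -> 0 < t.
Proof.
move=> nFs t0 Fm; rewrite lt_neqAle t0 andbT eq_sym; apply/eqP => e.
by apply: nFs; move: Fm; rewrite e mix0.
Qed.

(** The ray from the apex through any other point of [Q] meets the base. *)
Lemma foot x : Q x -> x != v -> exists2 k, 0 < k & F (mix k x v).
Proof.
move=> Qx xv; have [Px|/(cap_sub Qx)[f Ff [t /andP[t0 t1] xE]]] := pselect (P x).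
  have [t [t0 t1 Ft]] := cross Px; exists (1 - t); first by rewrite subr_gt0.
  by rewrite mixC (_ : 1 - (1 - t) = t) //; ring.
have t1' : t != 1 by apply: contra_neq xv => e; rewrite xE e mix1.
have k0 : 0 < 1 - t by rewrite subr_gt0 lt_neqAle t1' t1.
have kn0 := lt0r_neq0 k0.
exists (1 - t)^-1; first by rewrite invr_gt0.
rewrite (_ : mix _ _ _ = f) // xE.
by apply: eq_coord; rewrite /mix !coordE; field.
Qed.

Lemma foot_inj x k l : F (mix k x v) -> F (mix l x v) -> k = l.
Proof.
move=> /Fd + /Fd; rewrite !dot_mix => e1 e2.
have [h|h] := eqVneq (dot c x - dot c v) 0.
  by have := cv; nra.
by apply: (mulIf h); lra.
Qed.

(** A half-space supporting [P] and touching it away from the base still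
    contains the apex. *)
Lemma supports_apex h k s : (forall x, P x -> dot h x <= k) -> P s -> ~ F s ->
  dot h s = k -> dot h v <= k.
Proof.
move=> Pk Ps nFs sk; have [t [t0 t1 Ft]] := cross Ps.
have t0' := cross_gt0 nFs t0 Ft.
by have := Pk _ (FP Ft); rewrite dot_mix sk; nra.
Qed.

Lemma supports_ext h k : (forall x, P x -> dot h x <= k) -> dot h v <= k ->
  forall x, Q x -> dot h x <= k.
Proof.
move=> Pk vk x Qx; have [/Pk//|/(cap_sub Qx)[f /FP/Pk fk [t /andP[t0 t1] ->]]] := pselect (P x).
by rewrite dot_mix; nra.
Qed.

(** [S] together with the segments joining its points in the base to the apex.  The
    edges and faces of [P] become those of [Q] in this way, and are recovered by
    intersecting with [P]. *)
Definition prolong S : set V :=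
  S `|` [set x | exists2 f, S f /\ F f & exists2 t, 0 <= t <= 1 & x = mix t v f].

Lemma prolong_id S : (forall f, S f -> ~ F f) -> prolong S = S.
Proof.
move=> SF; apply/seteqP; split=> x; last by left.
by case=> // -[f [/SF]].
Qed.

Lemma prolongP S : S `<=` P -> prolong S `&` P = S.
Proof.
move=> SP; apply/seteqP; split=> [x [[//|[f [Sf Ff] [t /andP[t0 t1] xE]]] Px]|x Sx].
  have := Pd Px; rewrite xE dot_cap // => h.
  have t00 : t = 0 by have := cv; nra.
  by rewrite t00 mix0.
by split; [left|apply: SP].
Qed.

(** The set where a functional is equal to its value at the apex, provided that this
    set meets the base. *)
Lemma exposes_prolong h k : dot h v = k ->
  (exists2 f, F f & dot h f = k) ->
  Q `&` [set x | dot h x = k] = prolong (P `&` [set x | dot h x = k]).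
Proof.
move=> vk [g Fg gk]; apply/seteqP; split=> x.
  move=> [Qx /= xk]; have [Px|/(cap_sub Qx)[f Ff [t /andP[t0 t1] xE]]] := pselect (P x).
    by left.
  right; have [t1'|t1'] := eqVneq t 1.
    exists g; first by do ![split=> //]; apply: FP.
    by exists 1; rewrite ?ler01 ?lexx // xE t1' !mix1.
  exists f; last by exists t => //; rewrite t1 ltW.
  do ![split=> //]; first exact: FP.
  have : 0 < 1 - t by rewrite subr_gt0 lt_neqAle t1' t1.
  move: xk; rewrite /= xE dot_mix vk => xk t1p.
  by apply: (mulfI (lt0r_neq0 t1p)); lra.
move=> [[Px xk]|[f [[_ /= fk] Ff] [t /andP[t0 t1] ->]]]; first by split=> //; apply: PQ.
by split; [apply: cap_mix|rewrite /= dot_mix fk vk; ring].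
Qed.

Lemma exposes_same h k : (forall x, P x -> dot h x <= k) -> dot h v < k ->
  Q `&` [set x | dot h x = k] = P `&` [set x | dot h x = k].
Proof.
move=> Pk vk; apply/seteqP; split=> x [Qx /= xk]; last by split=> //; apply: PQ.
split=> //; apply: contrapT => /(cap_sub Qx)[f /FP/Pk fk [t /andP[t0 t1] xE]].
by move: xk; rewrite xE dot_mix; nra.
Qed.

(** An edge of [P] outside the base is prolonged to an edge of [Q].  If it
    touches the base at a point [u], then it is prolonged up to the apex: otherwise
    it would be an edge of [Q], and its endpoint [u] would be a vertex of [Q]. *)
Lemma edge_prolong E h k : edge P E -> ~ E `<=` F -> h != 0 -> exposes P h k E ->
  [/\ forall x, Q x -> dot h x <= k, Q `&` [set x | dot h x = k] = prolong E
    & edge Q (prolong E)].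
Proof.
move=> [eE E1] /existsNP[s /not_implyP[Es nFs]] h0 [Pk EE].
have EP x : E x -> P x by rewrite EE => -[].
have Ek x : E x -> dot h x = k by rewrite EE => -[].
have Ps := EP _ Es; have vk := supports_apex Pk Ps nFs (Ek _ Es).
have Qk := supports_ext Pk vk.
have edgeI D : Q `&` [set x | dot h x = k] = D -> has_dim 1 D -> edge Q D.
  move=> DE D1; split=> //; exists h; apply/outward_normalP; split=> //.
  by exists k; split.
move: (vk); rewrite le_eqVlt => /orP[/eqP vk'|vk'].
  have [t [t0 t1 Fu]] := cross Ps; set u := mix t v s in Fu.
  have {}t0 := cross_gt0 nFs t0 Fu.
  have uk : dot h u = k by rewrite dot_mix vk' Ek //; ring.
  have Eu : E u by rewrite EE; split=> //; apply: FP.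
  have us : u != s by apply/eqP => e; apply: nFs; rewrite -e.
  have eqE : Q `&` [set x | dot h x = k] = prolong E.
    by rewrite EE; apply: exposes_prolong => //; exists u.
  split=> //; apply: edgeI => //.
  apply: (@has_dim1I _ _ s u); [by left|by left|by rewrite eq_sym|].
  have su : s != u by rewrite eq_sym.
  have tn0 := lt0r_neq0 t0.
  have line z : E z -> exists l, z = mix l u s.
    by move=> Ez; apply: has_dim1_line E1 _ _ _ _.
  move=> z [/line//|[f [/line[l ->] _] [t' _ ->]]].
  exists (t' / t + (1 - t') * l).
  rewrite /u; apply: eq_coord; rewrite /mix !coordE.
  - by field.
  - by field.
  - by field.
(* Otherwise [E] is already an edge of [Q], hence does not touch the base. *)
have eqE := exposes_same Pk vk'; rewrite -EE in eqE.
have eQE : edge Q E by apply: edgeI.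
have noF f : E f -> ~ F f.
  move=> Ef Ff.
  have fE : [set f] = E `&` [set x | dot c x = d].
    apply/seteqP; split=> x; first by move=> ->; split=> //; apply: Fd.
    move=> [Ex /= xd]; have sf : s != f by apply/eqP => e; apply: nFs; rewrite e.
    have [l xE] := has_dim1_line E1 Es Ef Ex sf.
    have := ltd Ps nFs; move: xd; rewrite xE dot_mix Fd // => e lt.
    have -> : l = 1 by nra.
    by rewrite mix1.
  have vert S : (exists2 A, finite_set A & S = hull A) -> edge S E -> vertex S f.
    move=> polyS [[h1 hE] _]; split; last exact: has_dim0.
    by rewrite fE; apply: (face_of_face polyS hE) => x /EP/Pd.
  by apply: (noV (u := f)) => //; apply: vert.
by rewrite prolong_id.
Qed.

(** Every edge of [Q] arises in this way. *)
Lemma edge_trace D : edge Q D ->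
  [/\ edge P (D `&` P), ~ D `&` P `<=` F & D = prolong (D `&` P)].
Proof.
move=> eD; have [[h /outward_normalP[h0 [k exD]]] D1] := eD; have [Qk DE] := exD.
have Pk x : P x -> dot h x <= k by move/PQ/Qk.
have exP : exposes P h k (D `&` P).
  split=> //; rewrite DE; apply/seteqP; split=> x.
    by move=> [[_ ?] ?]; split.
  by move=> [Px ?]; do ![split=> //]; apply: PQ.
suff [eP nF] : edge P (D `&` P) /\ ~ D `&` P `<=` F.
  split=> //; have [_ + _] := edge_prolong eP nF h0 exP; move=> <-.
  exact: DE.
have exQ S : exposes P h k S -> exists a, outward_normal P S a.
  by move=> exS; exists h; apply/outward_normalP; split=> //; exists k.
have := Qk _ apex_in; rewrite le_eqVlt => /orP[/eqP vk|vk]; last first.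
  have DPE : D `&` P = D.
    have : D `<=` P by rewrite DE (exposes_same Pk vk) => x [].
    by move/setIidPl.
  rewrite DPE in exP *.
  have eP : edge P D by split=> //; apply: exQ.
  by split=> // DF; apply: (noE eP DF).
have Dv : D v by rewrite DE; split=> //; apply: apex_in.
have DQ x : D x -> Q x by rewrite DE => -[].
have Dk x : D x -> dot h x = k by rewrite DE => -[].
have [x Dx xv] : exists2 x, D x & x != v.
  have [x [y [Dx Dy xy]]] := has_dim1E D1.
  have [xv|xv] := eqVneq x v; last by exists x.
  by exists y => //; rewrite -xv eq_sym.
have [mu mu0 Fe] := foot (DQ _ Dx) xv; set e := mix mu x v in Fe.
have De : D e.
  by rewrite DE; split; [exact/PQ/FP|rewrite /= dot_mix vk Dk //; ring].
have ev : e != v by apply/eqP => eE; apply: apex_notin; rewrite -eE; apply: FP.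
have ve : v != e by rewrite eq_sym.
have onF s : D s -> F s -> s = e.
  move=> Ds /Fd sd; have [l sE] := has_dim1_line D1 Dv De Ds ve.
  move: sd; rewrite sE dot_mix (Fd Fe) => sd.
  have -> : l = 1 by have := cv; nra.
  by rewrite mix1.
have [[s [[Ds Ps] se]]|noS] := pselect (exists s, (D `&` P) s /\ s != e).
  have es : e != s by rewrite eq_sym.
  split; last first.
    by move=> /(_ s (conj Ds Ps)) /(onF _ Ds) eq; case/eqP: se.
  split; first exact: exQ.
  apply: (@has_dim1I _ _ e s) => //; first by split=> //; apply: FP.
  by move=> z [Dz _]; apply: has_dim1_line D1 _ _ _ _.
exfalso.
(* [D] would be the segment from [v] to [e], so that [e] would be a vertex of [Q]. *)
have DPe : D `&` P = [set e].
  apply/seteqP; split=> [z Dz|z ->]; last by split=> //; apply: FP.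
  by apply/eqP/negP => /negP ze; apply: noS; exists z.
apply: (noV (u := e)) => //.
  by rewrite DPe in exP; split; [exact: exQ|exact: has_dim0].
split; last exact: has_dim0.
have -> : [set e] = D `&` [set x | dot (- c) x = - d].
  apply/seteqP; split=> [z ->|z [Dz]]; first by split=> //=; rewrite dotNl Fd.
  by rewrite /= dotNl => /oppr_inj/(base_cut (DQ _ Dz))/(onF _ Dz).
have [[h1 hD] _] := eD; apply: (face_of_face polyQ hD) => z Dz.
rewrite dotNl lerN2; have [Pz|nPz] := pselect (P z); last exact/ltW/(cap_ge (DQ _ Dz)).
by have -> : z = e; [have : (D `&` P) z by []; rewrite DPe|rewrite Fd].
Qed.

(** A face of [Q] which misses the apex is a face of [P]. *)
Lemma face_off_apex G a b : has_dim 2 G -> a != 0 -> exposes Q a b G -> dot a v < b ->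
  face P G /\ G `<=` P.
Proof.
move=> G2 a0 [Qb GE] vb; have Pb x : P x -> dot a x <= b by move/PQ/Qb.
have {}GE : G = P `&` [set x | dot a x = b] by rewrite GE exposes_same.
split; last by rewrite GE => x [].
split=> //; exists a; apply/outward_normalP; split=> //; exists b; split=> //.
Qed.

(** A face of [Q] through the apex prolongs a face of [P] which meets the base
    in an edge. *)
Lemma face_trace G a b : has_dim 2 G -> a != 0 -> exposes Q a b G -> dot a v = b ->
  [/\ face P (G `&` P), exposes P a b (G `&` P), edge P (G `&` P `&` F)
    & G = prolong (G `&` P)].
Proof.
move=> G2 a0 exG vb; have [Qb GE] := exG.
have Gv : G v by rewrite GE; split=> //; apply: apex_in.
have Gb u : G u -> dot a u = b by rewrite GE => -[].
have GQ u : G u -> Q u by rewrite GE => -[].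
have Pb x : P x -> dot a x <= b by move/PQ/Qb.
have exP : exposes P a b (G `&` P).
  split=> //; rewrite GE; apply/seteqP; split=> x.
    by move=> [[_ ?] ?]; split.
  by move=> [Px ?]; do ![split=> //]; apply: PQ.
have [x [y [Gx Gy txy]]] := has_dim2E a0 Gb G2 Gv.
have xv : x != v by rewrite -subr_eq0; apply: triple_neq0 txy.
have yv : y != v.
  rewrite -subr_eq0; apply: (@triple_neq0 _ a _ (x - v)).
  by rewrite triple_swap oppr_eq0.
have [k k0 Fp] := foot (GQ _ Gx) xv; set p := mix k x v in Fp.
have [l l0 Fq] := foot (GQ _ Gy) yv; set q := mix l y v in Fq.
have pv : p - v = k *: (x - v) by rewrite mixBr.
have qv : q - v = l *: (y - v) by rewrite mixBr.
have tpq : triple a (p - v) (q - v) != 0.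
  by rewrite pv qv tripleZr tripleZl !mulf_neq0 // lt0r_neq0.
have ap : dot a p = b by rewrite dot_mix vb Gb //; ring.
have aq : dot a q = b by rewrite dot_mix vb Gb //; ring.
have GFI z : F z -> dot a z = b -> (G `&` P `&` F) z.
  by move=> Fz az; do ![split=> //]; [rewrite GE; split=> //; apply: PQ|]; apply: FP.
have Ep := GFI _ Fp ap; have Eq := GFI _ Fq aq.
have pq : p != q by apply: contra_neq tpq => ->; rewrite triplexx.
have dim1 : has_dim 1 (G `&` P `&` F).
  apply: (has_dim1I Ep Eq pq) => z [[Gz _] Fz].
  have [||||s [t zE]] := @triple_span _ a (p - v) (q - v) (z - v) a0.
  - by rewrite dotBr ap vb subrr.
  - by rewrite dotBr aq vb subrr.
  - exact: tpq.
  - by rewrite dotBr Gb // vb subrr.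
  have := congr1 (dot c) zE; rewrite dotBr dotDr !dotZr !dotBr (Fd Fz) (Fd Fp) (Fd Fq) => cE.
  have st : s = 1 - t.
    have dv : d - dot c v != 0 by rewrite subr_eq0 lt_eqF // cv.
    by apply: (mulIf dv); lra.
  exists t; have -> : z = v + (z - v) by rewrite addrC subrK.
  by rewrite zE st; apply: eq_coord; rewrite /mix !coordE; ring.
have edgePE : edge P (G `&` P `&` F).
  split=> //; exists (a + c); apply/outward_normalP; split.
    apply/eqP => e0; have := congr1 (dot^~ v) e0; have := congr1 (dot^~ p) e0.
    by rewrite /= !dotDl !dot0l ap vb (Fd Fp); have := cv; lra.
  exists (b + d); split.
    by move=> z Pz; rewrite dotDl lerD // ?Pb // Pd.
  apply/seteqP; split=> z.
    by move=> [[Gz Pz] Fz]; split=> //=; rewrite dotDl Gb // Fd.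
  move=> [Pz /=]; rewrite dotDl => e; have := Pb _ Pz; have := Pd Pz => h1 h2.
  by apply: GFI; [apply: FI => //; lra|lra].
(* If [P] met [G] in the base only, then this edge of the base would be an edge of
   [G], hence of [Q]. *)
have [s [Gs Ps nFs]] : exists s, [/\ G s, P s & ~ F s].
  apply: contrapT => noS; apply: (noE edgePE); first by move=> z [].
  split=> //.
  have -> : G `&` P `&` F = G `&` [set x | dot (- c) x = - d].
    apply/seteqP; split=> [z [[Gz _] Fz]|z [Gz]].
      by split=> //=; rewrite dotNl Fd.
    rewrite /= dotNl => /oppr_inj/(base_cut (GQ _ Gz)) Fz.
    by do ![split=> //]; apply: FP.
  have hG : outward_normal Q G a by apply/outward_normalP; split=> //; exists b.
  apply: (face_of_face polyQ hG) => z Gz; rewrite dotNl lerN2.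
  have [Pz|nPz] := pselect (P z); last exact/ltW/(cap_ge (GQ _ Gz)).
  have [Fz|nFz] := pselect (F z); first by rewrite Fd.
  by exfalso; apply: noS; exists z.
have GP2 : has_dim 2 (G `&` P).
  apply: (@has_dim2I _ _ a b p q s) => //; [|by case: Ep|by case: Eq|].
    by move=> u [/Gb].
  have qp0 : q - p != 0 by rewrite subr_eq0 eq_sym.
  apply/eqP => t0; have [|||m sE] := @triple_eq0 _ a (q - p) (s - p) a0 qp0.
  - by rewrite dotBr ap aq subrr.
  - by rewrite dotBr ap Gb // subrr.
  - exact: t0.
  have := congr1 (dot c) sE; rewrite dotZr !dotBr (Fd Fp) (Fd Fq) => e.
  by apply: nFs; apply: FI => //; lra.
split=> //.
  by split=> //; exists a; apply/outward_normalP; split=> //; exists b.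
rewrite (proj2 exP) GE.
by apply: exposes_prolong => //; exists p.
Qed.

Lemma face_prolong_sub G a b E : exposes Q a b G -> dot a v = b -> E `<=` G ->
  prolong E `<=` G.
Proof.
move=> [_ ->] vb EG x [/EG//|[f [/EG[Qf /= fb] Ff] [t /andP[t0 t1] ->]]].
by split; [exact: cap_mix|rewrite /= dot_mix vb fb; ring].
Qed.

(** An edge of [P] with one end [y] in the base grows into the segment from the apex to
    its other end. *)
Lemma prolong_segment_apex y z : edge P (segment y z) -> F y -> ~ F z ->
  prolong (segment y z) = segment v z /\
  exists t, [/\ 0 < t, t < 1 & y = mix t v z].
Proof.
move=> eE Fy nFz; have [[h /outward_normalP[h0 [k exE]]] E1] := eE.
have nEF : ~ segment y z `<=` F by move/(_ z (segmentr _ _)).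
have [Qk QEE _] := edge_prolong eE nEF h0 exE.
have [Pk EE] := exE.
have Ez : segment y z z := segmentr _ _; have Ey : segment y z y := segmentl _ _.
have EP x : segment y z x -> P x by rewrite EE => -[].
have Ek x : segment y z x -> dot h x = k by rewrite EE => -[].
have vk : dot h v = k.
  have : prolong (segment y z) v.
    by right; exists y => //; exists 1; rewrite ?mix1 // ler01 lexx.
  by rewrite -QEE => -[].
have onF f : segment y z f -> F f -> f = y.
  move=> /segmentP[t _ ->] /Fd; rewrite dot_mix (Fd Fy) => e.
  have := ltd (EP _ Ez) nFz => lt.
  have -> : t = 1 by nra.
  by rewrite mix1.
have [t [t0 t1 Ft]] := cross (EP _ Ez).
have ty : mix t v z = y.
  apply: onF => //; rewrite EE; split; first exact: FP.
  by rewrite /= dot_mix vk Ek //; ring.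
split; last by exists t; split=> //; apply: (cross_gt0 nFz t0 Ft).
have vz : segment v z y.
  by apply/segmentP; exists t; rewrite ?t0 ?(ltW t1) // ty.
apply/seteqP; split.
  move=> x [Ex|[f [Ef Ff] [s s01 ->]]].
    move: Ex; apply: segment_sub => //; [exact: hull_convex|exact: segmentr].
  rewrite (onF _ Ef Ff); case/andP: s01 => s0 s1.
  by apply: (hull_convex s0 s1) => //; apply: segmentl.
apply: segment_sub.
- rewrite -QEE; apply: convexI => //; exact: convex_plane.
- by right; exists y => //; exists 1; rewrite ?mix1 // ler01 lexx.
- by left.
Qed.

Lemma prolong_segment_id y z : P y -> P z -> ~ F y -> ~ F z ->
  prolong (segment y z) = segment y z.
Proof.
move=> Py Pz nFy nFz; apply: prolong_id => f /segmentP[t /andP[t0 t1] ->] /Fd.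
rewrite dot_mix => e; have ly := ltd Py nFy; have lz := ltd Pz nFz.
have [t00|tn0] := eqVneq t 0; first by move: e; rewrite t00; lra.
by have t0' : 0 < t; [rewrite lt_neqAle eq_sym tn0|nra].
Qed.

Lemma boundary_off_apex G a b us : has_dim 2 G -> a != 0 -> exposes Q a b G ->
  dot a v < b -> anticlockwise_boundary P G us -> anticlockwise_boundary Q G us.
Proof.
move=> G2 a0 exG vb [U1 U2 [a1 nG1 U3]].
have [fG GP] := face_off_apex G2 a0 exG vb.
have [Qb GE] := exG.
have nG : outward_normal Q G a by apply/outward_normalP; split=> //; exists b.
split=> //.
  move=> E; rewrite -U2; split=> -[eE EG]; split=> //.
    have [eEP _ _] := edge_trace eE; move: eEP.
    by rewrite (_ : E `&` P = E) //; apply/setIidPl => x /EG/GP.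
  have [[h /outward_normalP[h0 [k [Pk EE]]]] E1] := eE; split=> //.
  have -> : E = G `&` [set x | dot h x = k].
    apply/seteqP; split=> x; first by move=> Ex; split; [exact: EG|move: Ex; rewrite EE => -[]].
    by move=> [/GP Px hx]; rewrite EE; split.
  by apply: (face_of_face polyQ nG) => x /GP/Pk.
exists a => // p x pus Gx.
have nPG : outward_normal P G a.
  apply/outward_normalP; split=> //; exists b; split; first by move=> y /PQ/Qb.
  rewrite {1}GE; apply/seteqP; split=> y; last by move=> [/PQ].
  by move=> [Qy yb]; split=> //; apply: GP; rewrite GE.
have [k k0 ->] := facet_normal P3 G2 nPG nG1.
by rewrite tripleZn; apply: mulr_ge0; [exact: ltW|exact: U3].
Qed.

(** When an edge of the base from [p] to [q] disappears, [p] is dropped and [q] is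
    replaced by the apex in the list of vertices. *)
Definition merge q y : V := if y == q then v else y.

(** The boundary of a face of [Q] through the apex, in terms of that of the face of
    [P] which it prolongs. *)
Lemma boundary_prolong G a b us : has_dim 2 G -> a != 0 -> exposes Q a b G ->
  dot a v = b -> anticlockwise_boundary P (G `&` P) us ->
  exists2 p, p \in us & let q := next us p in
  let us' := [seq merge q y | y <- us & y != p] in
  [/\ G `&` P `&` F = segment p q, next us q != p,
      anticlockwise_boundary Q G us'
    & forall y, y \in us -> y != p ->
        next us' (merge q y) = merge q (skip us p y) /\
        prolong (segment y (next us y)) = segment (merge q y) (merge q (skip us p y))].
Proof.
move=> G2 a0 exG vb [U1 U2 [a1 nG1 U3]].
have [[nH H2] exH edgeE0 GE] := face_trace G2 a0 exG vb.
set H := G `&` P in U2 nG1 U3 nH H2 exH edgeE0 GE *.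
have nG : outward_normal Q G a by apply/outward_normalP; split=> //; exists b.
have nHa : outward_normal P H a by apply/outward_normalP; split=> //; exists b.
have HG x : H x -> G x by case.
have HP x : H x -> P x by case.
have Hb x : H x -> dot a x = b by rewrite (proj2 exH) => -[].
have orient y x : y \in us -> H x -> 0 <= triple a (next us y - y) (x - y).
  move=> yus Hx; have [k k0 ->] := facet_normal P3 H2 nHa nG1.
  by rewrite tripleZn; apply: mulr_ge0; [exact: ltW|exact: U3].
have [p pus E0E] := (U2 _).1 (conj edgeE0 (@subIsetl _ H F)).
exists p => // q; rewrite -/q in E0E.
have qus : q \in us by rewrite mem_next.
have edgeU y : y \in us -> edge P (segment y (next us y)) /\ segment y (next us y) `<=` H.
  by move=> yus; apply/U2; exists y.
have usH y : y \in us -> H y by move=> /edgeU[_]; apply; apply: segmentl.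
have usP y : y \in us -> P y by move/usH/HP.
have pq : p != q by apply: segment_edge_neq (proj1 (edgeU p pus)).
have E0F x : segment p q x -> F x by rewrite -E0E => -[].
have no2 : next us q != p.
  (* Otherwise the face lies on both sides of the line through [p] and [q]. *)
  apply/eqP => qp.
  have [x [y [Hx Hy txy]]] := has_dim2E a0 Hb H2 (usH _ pus).
  have flat z : H z -> triple a (q - p) (z - p) = 0.
    move=> Hz; apply/eqP; rewrite eq_le (orient _ _ pus Hz) andbT.
    have := orient _ _ qus Hz; rewrite qp.
    have -> : triple a (p - q) (z - q) = - triple a (q - p) (z - p).
      by rewrite !tripleE !coordE; ring.
    by rewrite oppr_ge0.
  have qp0 : q - p != 0 by rewrite subr_eq0 eq_sym.
  have par z : H z -> exists k, z - p = k *: (q - p).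
    move=> Hz; apply: (triple_eq0 a0 qp0 _ _ (flat _ Hz)).
      by rewrite dotBr !Hb ?subrr //; apply: usH.
    by rewrite dotBr !Hb ?subrr //; apply: usH.
  have [k xE] := par _ Hx; have [l yE] := par _ Hy.
  by move: txy; rewrite xE yE tripleZl tripleZr triplexx !mulr0 eqxx.
have onE0 y : y \in us -> segment y (next us y) `<=` F -> y = p.
  move=> yus yF; have [eD DH] := edgeU _ yus.
  have inE0 z : segment y (next us y) z -> segment p q z.
    by move=> Dz; rewrite -E0E; split; [exact: DH|exact: yF].
  have eE0 : edge P (segment p q) by rewrite -E0E.
  have := edge_eq eD eE0 (segmentl _ _) (segmentr _ _) (inE0 _ (segmentl _ _))
    (inE0 _ (segmentr _ _)) (segment_edge_neq eD).
  move/segment_inj => [[//]|[yq yp]].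
  by move: no2; rewrite -yp -yq eqxx.
have vert y : y \in us -> F y -> y = p \/ y = q.
  move=> yus Fy; have [eD DH] := edgeU _ yus.
  have : segment p q y by rewrite -E0E; split=> //; apply: usH.
  move=> /segmentP[t /andP[t0 t1] yE].
  have [t00|tn0] := eqVneq t 0; first by right; rewrite yE t00 mix0.
  have [t11|tn1] := eqVneq t 1; first by left; rewrite yE t11 mix1.
  have t0' : 0 < t by rewrite lt_neqAle eq_sym tn0.
  have t1' : t < 1 by rewrite lt_neqAle tn1.
  left; apply: onE0 => //.
  have [[h /outward_normalP[_ [k exD]]] _] := eD.
  have Dy : segment y (next us y) (mix t p q) by rewrite -yE; apply: segmentl.
  have [Dp Dq] := exposes_absorb exD (usP _ pus) (usP _ qus) t0' t1' Dy.
  have eE0 : edge P (segment p q) by rewrite -E0E.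
  by rewrite (edge_eq eD eE0 Dp Dq (segmentl _ _) (segmentr _ _) pq).
(* The new edge at [y] is the prolongation of the old one, and has the same
   direction. *)
have step y : y \in us -> y != p ->
    prolong (segment y (next us y)) = segment (merge q y) (merge q (skip us p y)) /\
    exists2 l, 0 < l & exists k,
      merge q (skip us p y) - merge q y = l *: (next us y - y) /\
      merge q y = y + k *: (next us y - y).
  move=> yus yp; have [eD DH] := edgeU _ yus; set z := next us y in eD DH *.
  have zus : z \in us by rewrite mem_next.
  rewrite /skip -/z -/q; have [yq|yq] := eqVneq y q.
    have zp : z != p by rewrite /z yq.
    have zq : z != q by rewrite -yq eq_sym; apply: segment_edge_neq eD.
    have nFz : ~ F z by move/(vert _ zus) => [zE|zE]; [case/eqP: zp|case/eqP: zq].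
    have Fy : F y by rewrite yq; apply: E0F; apply: segmentr.
    rewrite /merge yq eqxx (negPf zp) (negPf zq) -yq.
    have [-> [t [t0 t1 yE]]] := prolong_segment_apex eD Fy nFz.
    have tn0 := lt0r_neq0 t0.
    split=> //; exists t^-1; first by rewrite invr_gt0.
    exists (- ((1 - t) / t)); rewrite yE.
    by split; apply: eq_coord; rewrite /mix !coordE; field.
  have nFy : ~ F y by move/(vert _ yus) => [yE|yE]; [case/eqP: yp|case/eqP: yq].
  have [zp|zp] := eqVneq z p.
    have Fz : F z by rewrite zp; apply: E0F; apply: segmentl.
    rewrite /merge (negPf yq) eqxx.
    have eD' : edge P (segment z y) by rewrite segmentC.
    have [e [t [t0 t1 zE]]] := prolong_segment_apex eD' Fz nFy.
    have tn0 := lt0r_neq0 t0.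
    split; first by rewrite segmentC e segmentC.
    exists t^-1; first by rewrite invr_gt0.
    by exists 0; rewrite zE; split; apply: eq_coord; rewrite /mix !coordE; field.
  have zq : z != q by apply: contra_neq yp => /(next_inj U1).
  have nFz : ~ F z by move/(vert _ zus) => [zE|zE]; [case/eqP: zp|case/eqP: zq].
  rewrite /merge (negPf yq) (negPf zq); split.
    by apply: prolong_segment_id => //; apply: usP.
  by exists 1 => //; exists 0; rewrite scale1r scale0r addr0.
have mergeI : {in us &, injective (merge q)}.
  move=> y z /usP Py /usP Pz; rewrite /merge.
  have [->|yq] := eqVneq y q; have [->|zq] := eqVneq z q => // e.
    by case: apex_notin; rewrite e.
  by case: apex_notin; rewrite -e.
have sub : {subset [seq y <- us | y != p] <= us}.
  by move=> y; rewrite mem_filter => /andP[].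
have mergeI' : {in [seq y <- us | y != p] &, injective (merge q)}.
  by move=> y z /sub yus /sub zus; apply: mergeI.
have U1' : uniq [seq y <- us | y != p] by apply: filter_uniq.
have nextE y : y \in us -> y != p ->
    next [seq merge q y | y <- us & y != p] (merge q y) = merge q (skip us p y).
  by move=> yus yp; rewrite next_map_in ?next_skip // mem_filter yp.
split=> //; last by move=> y yus yp; split; [exact: nextE|case: (step _ yus yp)].
split.
- by rewrite map_inj_in_uniq.
- move=> E; split.
    move=> [eE EG]; have [eEP nEF EE] := edge_trace eE.
    have EH : E `&` P `<=` H by move=> x [/EG].
    have [y yus EPE] := (U2 _).1 (conj eEP EH).
    have yp : y != p by apply/eqP => yp; apply: nEF; rewrite EPE yp.
    exists (merge q y); first by rewrite map_f // mem_filter yp.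
    by rewrite nextE // EE EPE; case: (step _ yus yp).
  move=> [x /mapP[y]]; rewrite mem_filter => /andP[yp yus] -> ->.
  rewrite nextE //; have [<- _] := step _ yus yp.
  have [eD DH] := edgeU _ yus.
  have nDF : ~ segment y (next us y) `<=` F.
    by move/(onE0 _ yus)/eqP; apply/negP.
  have [[h /outward_normalP[h0 [k exD]]] _] := eD.
  have [_ _ eQ] := edge_prolong eD nDF h0 exD.
  by split=> //; apply: face_prolong_sub exG vb _ => w /DH/HG.
- exists a => // w X /mapP[y]; rewrite mem_filter => /andP[yp yus] -> GX.
  rewrite nextE //; have [_ [l l0 [k [-> ->]]]] := step _ yus yp.
  have [eD DH] := edgeU _ yus; set m := next us y - y.
  have -> : triple a (l *: m) (X - (y + k *: m)) = l * triple a m (X - y).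
    by rewrite !tripleE !coordE; ring.
  apply: mulr_ge0; first exact: ltW.
  have mixT t x z : triple a m (mix t x z - y)
      = t * triple a m (x - y) + (1 - t) * triple a m (z - y).
    by rewrite !tripleE /mix !coordE; ring.
  move: GX; rewrite GE => -[HX|[f [Hf _] [t /andP[t0 t1] ->]]]; first exact: orient.
  have Tf := orient _ _ yus Hf; rewrite -/m in Tf.
  (* The half-plane to the left of an edge contains the apex too, since it contains
     the crossing point of the base with the segment from the apex to a point [s]
     of this edge. *)
  have nDF : ~ segment y (next us y) `<=` F.
    by move/(onE0 _ yus)/eqP; apply/negP.
  have /existsNP[s /not_implyP[Ds nFs]] := nDF.
  have Hs := DH _ Ds.
  have Ts : triple a m (s - y) = 0.
    have /segmentP[r _ ->] := Ds.
    by rewrite mixC mixT subrr triplexx tripleE !coordE; ring.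
  have [r [r0 r1 Fe]] := cross (HP _ Hs).
  have {}r0 := cross_gt0 nFs r0 Fe.
  have He : H (mix r v s).
    by rewrite (proj2 exH); split; [exact: FP|rewrite /= dot_mix vb Hb //; ring].
  have := orient _ _ yus He; rewrite -/m mixT Ts mulr0 addr0 pmulr_rge0 // => Tv.
  by rewrite mixT addr_ge0 // mulr_ge0 // subr_ge0.
Qed.

(** * Labellings *)

(** A coherent labelling of [P] induces one of [Q]: in each face through the apex
    exactly one label disappears, that of the edge in the base. *)
Lemma coherent_trace (L : set V -> int) : coherent P L ->
  coherent Q (fun E => L (E `&` P)).
Proof.
move=> cohL G [[a /outward_normalP[a0 [b exG]]] G2].
have [Qb GE] := exG.
have := Qb _ apex_in; rewrite le_eqVlt => /orP[/eqP vb|vb]; last first.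
  have [fG GP] := face_off_apex G2 a0 exG vb.
  have [us bus sus] := cohL _ fG.
  exists us; first exact: (boundary_off_apex G2 a0 exG vb).
  rewrite (@eq_in_map _ _ _ (fun p => L (segment p (next us p))) us).1 //.
  move=> p pus /=; congr L; apply/setIidPl => x px; apply: GP.
  have [_ U2 _] := bus; have [_] : edge P (segment p (next us p)) /\
    segment p (next us p) `<=` G by apply/U2; exists p.
  exact.
have [fG _ _ _] := face_trace G2 a0 exG vb.
have [us bus sus] := cohL _ fG.
have [p pus [E0E no2 bus' step]] := boundary_prolong G2 a0 exG vb bus.
set us' := map _ _ in bus' step; exists us' => //.
rewrite /us' -map_comp -/us'.
have -> : [seq (fun x => L (segment x (next us' x) `&` P)) (merge (next us p) y)
    | y <- us & y != p]
  = [seq L (segment y (next us y)) | y <- us & y != p].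
  apply/eq_in_map => y /=; rewrite mem_filter => /andP[yp yus].
  have [-> <-] := step _ yus yp; rewrite prolongP //.
  have [_ U2 _] := bus.
  have [_ sG] : edge P (segment y (next us y)) /\
    segment y (next us y) `<=` G `&` P by apply/U2; exists y.
  by move=> x /sG[].
apply: subseq_sorted sus; first exact: lt_trans.
by apply: map_subseq; apply: filter_subseq.
Qed.

Lemma base_normal_neq0 : c != 0.
Proof.
have [f /Fd fd] := F0; apply/eqP => c00.
by move: fd cv; rewrite c00 !dot0l => ->; rewrite ltxx.
Qed.

Lemma apex_foot_uniq w x y : F x -> F y -> segment v w x -> segment v w y -> x = y.
Proof.
move=> Fx Fy /segmentP[s _ xE] /segmentP[t _ yE].
have : F (mix (1 - s) w v) by rewrite mixC subKr -xE.
move/foot_inj => /(_ (1 - t)); rewrite mixC subKr -yE => /(_ Fy) e.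
by rewrite xE yE (_ : s = t) //; lra.
Qed.

(** Two edges of [Q] at the apex which lie in a common face [G], the first one turning
    clockwise to the second, are joined by an edge of the base.  Its label in [P]
    lies between theirs in the cyclic order, and the anticlockwise boundary of the base
    traverses it from the second to the first. *)
Lemma corner (L : set V -> int) G a w w' us : coherent P L -> has_dim 2 G ->
  outward_normal Q G a -> segment v w `<=` G -> segment v w' `<=` G ->
  edge Q (segment v w) -> edge Q (segment v w') ->
  triple a (w - v) (w' - v) < 0 -> anticlockwise_boundary P F us ->
  exists p q, [/\ F p /\ segment v w p, F q /\ segment v w' q,
    q \in us, next us q = p
  & cyc (L (segment v w `&` P)) (L (segment p q)) (L (segment v w' `&` P))].
Proof.
move=> cohL G2 nG wG w'G ew ew' neg [V1 V2 [c' nFc' V3]].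
have /outward_normalP[a0 [b exG]] := nG; have [Qb GE] := exG.
have vb : dot a v = b by have := wG v (segmentl _ _); rewrite GE => -[].
have [fG exH eE0 _] := face_trace G2 a0 exG vb.
have [us0 bus sus] := cohL _ fG.
have [p pus [E0E no2 [_ U2' [a2 nG2 U3']] step]] := boundary_prolong G2 a0 exG vb bus.
set q := next us0 p in E0E no2 U2' U3' step.
set us' := map _ _ in U2' U3' step.
have [U1 U2 [a1 nH1 U3]] := bus.
set H := G `&` P in fG exH eE0 bus U2 nH1 U3 E0E.
have qus : q \in us0 by rewrite mem_next.
have edgeU y : y \in us0 -> edge P (segment y (next us0 y)) /\ segment y (next us0 y) `<=` H.
  by move=> yus; apply/U2; exists y.
have usH y : y \in us0 -> H y by move=> /edgeU[_]; apply; apply: segmentl.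
have usv y : y \in us0 -> y != v.
  by move=> /usH[_ Py]; apply/eqP => yv; apply: apex_notin; rewrite -yv.
have pq : p != q by apply: segment_edge_neq (proj1 (edgeU p pus)).
have qp : q != p by rewrite eq_sym.
have mergev y : y \in us0 -> merge q y = v -> y = q.
  by rewrite /merge; case: eqVneq => // _ /usv /eqP yv.
(* The two edges of [G] at the apex prolong those at [q] and at [p]. *)
have apex_edges w0 : edge Q (segment v w0) -> segment v w0 `<=` G ->
     (w0 = next us' v /\ segment v w0 = prolong (segment q (next us0 q)))
  \/ (exists2 y, [/\ y \in us0, y != p & next us0 y = p]
        & w0 = y /\ segment v w0 = prolong (segment y p)).
  move=> e0 s0; have [x xus' xE] := (U2' _).1 (conj e0 s0).
  move: xus' xE => /mapP[y]; rewrite mem_filter => /andP[yp yus] ->.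
  have [-> pE] := step _ yus yp; rewrite -pE => wE.
  move: (wE); rewrite pE => /segment_inj[[vE w0E]|[vE w0E]].
    left; have yq : y = q by apply: mergev.
    have [nE _] := step _ yus yp.
    by split; [rewrite w0E -nE -vE|rewrite wE yq].
  right; have zE : skip us0 p y = q.
    apply: mergev => //; rewrite /skip; case: ifP => _; by rewrite !mem_next.
  have yp' : next us0 y = p.
    move: zE; rewrite /skip; case: eqVneq => // _ /(next_inj U1) yE.
    by rewrite yE eqxx in yp.
  exists y => //; split; last by rewrite wE yp'.
  rewrite w0E /merge; case: eqVneq => // yq.
  by move: no2; rewrite -yq yp' eqxx.
have [z [zus zp zE] [wz wP]] : exists2 y, [/\ y \in us0, y != p & next us0 y = p]
        & w = y /\ segment v w = prolong (segment y p).
  have [[wE _]|//] := apex_edges _ ew wG.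
  exfalso; have vus' : v \in us'.
    apply/mapP; exists q; first by rewrite mem_filter qp.
    by rewrite /merge eqxx.
  have := U3' v w' vus' (w'G _ (segmentr _ _)); rewrite -wE.
  have [k k0 aE] := facet_normal Q3 G2 nG nG2.
  by move: neg; rewrite aE tripleZn pmulr_rlt0 // ltNge => /negP.
have [_ w'P] : w' = next us' v /\ segment v w' = prolong (segment q (next us0 q)).
  have [//|[y [yus yp yE] [w'y _]]] := apex_edges _ ew' w'G.
  exfalso; move: neg; rewrite wz w'y.
  have -> : y = z by apply: (next_inj U1); rewrite yE zE.
  by rewrite triplexx ltxx.
have E0F x : segment p q x -> F x by rewrite -E0E => -[].
have [Fp Fq] : F p /\ F q by split; apply: E0F; [exact: segmentl|exact: segmentr].
have segP y : y \in us0 -> segment y (next us0 y) `<=` P.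
  by move=> /edgeU[_ sH] x /sH[].
exists p, q.
(* The adjacent faces [H] and [F] traverse their common edge in opposite
   directions. *)
have [qusF nqp] : q \in us /\ next us q = p.
  have [s sus' sE] := (V2 _).1 (conj (proj1 (edgeU p pus)) E0F).
  have [[ps qs]|[ps qs]] := segment_inj sE; last first.
    by rewrite -/q in qs; rewrite qs -ps.
  exfalso; rewrite -/q in qs.
  have Hb x : H x -> dot a x = b by rewrite (proj2 exH) => -[].
  have [X FX aX] : exists2 X, F X & dot a X < b.
    apply: contrapT => noX.
    apply: (has_dim2_not_segment (q := q) base_normal_neq0 Fd F2 Fp) => x Fx.
    rewrite -E0E; split=> //; rewrite (proj2 exH); split=> /=; first exact: FP.
    apply/eqP; rewrite eq_le (proj1 exH _ (FP Fx)) /= leNgt; apply/negP => lt.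
    by apply: noX; exists x.
  have [Y HY cY] : exists2 Y, H Y & dot c Y < d.
    apply: contrapT => noY.
    apply: (has_dim2_not_segment (q := q) a0 Hb (proj2 fG) (usH _ pus)) => x Hx.
    rewrite -E0E; split=> //; apply: contrapT => nFx.
    by apply: noY; exists x => //; apply: ltd => //; case: Hx.
  apply: (@opposite_turns _ a c (q - p) (X - p) (Y - p) a0 base_normal_neq0).
  - by rewrite subr_eq0.
  - by rewrite dotBr !Hb ?subrr //; apply: usH.
  - by rewrite dotBr !Fd ?subrr.
  - by rewrite dotBr !Fd ?subrr.
  - by rewrite dotBr (Hb p) ?subr_lt0 //; apply: usH.
  - by rewrite dotBr !Hb ?subrr //; apply: usH.
  - by rewrite dotBr (Fd Fp) subr_lt0.
  - have nF : outward_normal P F c.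
      by apply/outward_normalP; split; [exact: base_normal_neq0|exists d].
    have [k k0 ->] := facet_normal P3 F2 nF nFc'.
    rewrite tripleZn; apply: mulr_ge0; first exact: ltW.
    by rewrite ps qs; apply: V3.
  - have nHa : outward_normal P H a by apply/outward_normalP; split=> //; exists b.
    have [k k0 ->] := facet_normal P3 (proj2 fG) nHa nH1.
    by rewrite tripleZn; apply: mulr_ge0; [exact: ltW|apply: U3].
split=> //.
- by split=> //; rewrite wP; left; apply: segmentr.
- by split=> //; rewrite w'P; left; apply: segmentl.
rewrite wP w'P !prolongP; [|exact: segP|by rewrite -zE; apply: segP].
have := @next_cyc _ us0 (fun y => L (segment y (next us0 y))) z U1 sus zus.
rewrite zE -/q; apply; apply: contra_neq no2 => ->.
by [].
Qed.

(** Some edge of [Q] ends at the apex: rotate a plane supporting [Q] at the apex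
    alone until it touches another generator of [Q]. *)
Lemma apex_edge (L : set V -> int) : coherent P L -> exists2 E, edge Q E & E v.
Proof.
move=> cohL; have [A finA QA] := polyQ; have c0 := base_normal_neq0.
have AQ x : A x -> Q x by move=> Ax; rewrite QA; apply: sub_hull.
have lt_apex x : Q x -> x != v -> dot c x < dot c v.
  move=> Qx xv; have [Px|/(cap_sub Qx)[f Ff [t /andP[t0 t1] xE]]] := pselect (P x).
    exact: le_lt_trans (Pd Px) cv.
  have : t != 1 by apply: contra_neq xv => t11; rewrite xE t11 mix1.
  move=> tn1; have {}t1 : t < 1 by rewrite lt_neqAle tn1.
  by rewrite xE dot_cap //; have := cv; nra.
have [f0 Ff0] := F0.
have [x0 Ax0 x0v] : exists2 x, A x & x != v.
  apply: contrapT => noA; have : Q `<=` [set v].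
    rewrite QA; apply: hull_min => [t x y _ _ -> ->|x Ax] /=.
      by apply: eq_coord; rewrite /mix !coordE; ring.
    by apply/eqP/negP => /negP xv; apply: noA; exists x.
  move=> /(_ _ (PQ (FP Ff0))) fv; apply: apex_notin; rewrite -fv; exact: FP.
have [x1 [y1 [Fx1 _ t0]]] := has_dim2E c0 Fd F2 Ff0.
pose m := x1 - f0; have m0 : m != 0 := triple_neq0 t0.
have cm : dot c m = 0 by rewrite dotBr (Fd Fx1) (Fd Ff0) subrr.
pose ratio y := dot m (y - v) / (dot c v - dot c y).
have finA' : finite_set (A `\ v) by apply: finite_setD.
have [x [Ax /eqP xv] xmax] := @finite_max _ (A `\ v) ratio x0 finA' (conj Ax0 (elimN eqP x0v)).
(* The choice of [x] makes this functional maximal at both [v] and [x]. *)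
pose h := m + ratio x *: c.
have h0 : h != 0.
  apply/eqP => h0; have := congr1 (dot^~ m) h0; rewrite /= dotDl dotZl cm dot0l mulr0 addr0.
  by apply/eqP; rewrite gt_eqF // dotxx_gt0.
have hE y : dot h y = dot h v + (dot m (y - v) - ratio x * (dot c v - dot c y)).
  by rewrite /h /m !dotE !coordE; ring.
have Qh y : Q y -> dot h y <= dot h v.
  rewrite QA; move: y; apply: hull_min; first exact: convex_halfspace.
  move=> y Ay /=; have [->//|yv] := eqVneq y v.
  rewrite hE gerDl subr_le0 -ler_pdivrMr ?subr_gt0.
    by apply: xmax; split=> //; apply/eqP.
  by apply: lt_apex => //; apply: AQ.
have Qx := AQ _ Ax.
pose S := Q `&` [set y | dot h y = dot h v].
have Sv : S v by split=> //; apply: apex_in.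
have Sx : S x.
  split=> //=; rewrite hE /ratio divfK ?subrr ?addr0 //.
  by rewrite gt_eqF // subr_gt0 lt_apex.
have Sh y : S y -> dot h y = dot h v by case.
have exS : exposes Q h (dot h v) S by [].
have nS : exists a, outward_normal Q S a.
  by exists h; apply/outward_normalP; split=> //; exists (dot h v).
have vx : v != x by rewrite eq_sym.
(* [S] contains [v] and [x]: it is an edge, or a face, whose boundary then passes
   through the apex. *)
have [line|] := pselect (forall z, S z -> exists k, z = mix k x v).
  by exists S => //; split=> //; apply: has_dim1I Sv Sx vx line.
move=> /existsNP[z /not_implyP[Sz nline]].
have S2 : has_dim 2 S.
  apply: (has_dim2I h0 Sh Sv Sx Sz); apply/eqP => t00; apply: nline.
  have xv0 : x - v != 0 by rewrite subr_eq0 eq_sym.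
  have [||k zE] := triple_eq0 h0 xv0 _ _ t00.
  - by rewrite dotBr (Sh _ Sx) subrr.
  - by rewrite dotBr (Sh _ Sz) subrr.
  by exists k; rewrite mixE -zE addrC subrK.
have [fS _ _ _] := face_trace S2 h0 exS erefl.
have [us bus _] := cohL _ fS.
have [p pus [_ no2 [_ U2 _] step]] := boundary_prolong S2 h0 exS erefl bus.
set q := next us p in no2 U2 step; set us' := map _ _ in U2 step.
have qp : q != p by apply: contra_neq no2 => qp; rewrite qp.
exists (segment v (next us' v)); last exact: segmentl.
have [] : edge Q (segment v (next us' v)) /\ segment v (next us' v) `<=` S => //.
apply/U2; exists v => //; apply/mapP; exists q; last by rewrite /merge eqxx.
by rewrite mem_filter qp mem_next.
Qed.
End Cap.

Theorem theorem7p8 (R : realType) (P Q F : set 'rV[R]_3) (v : 'rV[R]_3)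
    (hP : convex_polyhedron P) (hQ : convex_polyhedron Q)
    (hF : face P F) (hPQ : attach_pyramid P F v Q)
    (h1 : coherently_labellable Q)
    (h2 : forall L : set 'rV[R]_3 -> int,
      coherent Q L -> clockwise_coherent_at Q L v) :
  ~ coherently_labellable P.
Proof.
move=> [L cohL].
have [polyP P3] := hP; have [polyQ Q3] := hQ; have [_ F2] := hF.
have [[c /outward_normalP[_ [d exF]] cFv] QE noE noV] := hPQ.
have F0 : exists f, F f by case: F2 => f Ff _; exists f.
have cv : d < dot c v.
  by have [f Ff] := F0; have := cFv _ Ff; move: Ff; rewrite {1}(proj2 exF) => -[_ /= ->].
have cohQ := coherent_trace polyP polyQ F0 exF cv QE P3 noE noV cohL.
have [ws [W1 W2 W3] Wsorted] := h2 _ cohQ.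
have [us bus sus] := cohL _ hF.
pose e w := L (segment v w `&` P).
have edgeW w : w \in ws -> edge Q (segment v w).
  by move=> wws; have [] : edge Q (segment v w) /\ segment v w v by apply/W2; exists w.
have cornerW w : w \in ws -> exists p q, [/\ F p /\ segment v w p,
    F q /\ segment v (next ws w) q, q \in us, next us q = p
    & cyc (e w) (L (segment p q)) (e (next ws w))].
  move=> wws; have [G [a [[_ G2] nG wG w'G neg]]] := W3 _ wws.
  apply: (corner polyP polyQ F0 exF cv QE P3 Q3 F2 noE noV cohL G2 nG wG w'G _ _ neg bus).
    exact: edgeW.
  by apply: edgeW; rewrite mem_next.
have same w x y : F x /\ segment v w x -> F y /\ segment v w y -> x = y.
  by move=> [Fx wx] [Fy wy]; apply: (apex_foot_uniq exF cv Fx Fy wx wy).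
have [E eE Ev] := apex_edge polyP polyQ F0 exF cv QE P3 F2 noE noV cohL.
have [w0 w0ws _] := (W2 E).1 (conj eE Ev).
have [U1 _ _] := bus.
case: ws => [//|w1 [|w2 [|w3 t]]] in W1 W2 W3 Wsorted edgeW cornerW w0ws *.
(* With a single edge at the apex the turn to the next edge would be trivial. *)
- have [G [a [_ _ _ _]]] := W3 w1 (mem_head _ _).
  by rewrite /= eqxx triplexx ltxx.
(* With two edges at the apex, the label of the same edge of the base would lie both
   between the two labels and outside of them. *)
- have w21 : w2 != w1 by move: W1; rewrite /= inE eq_sym => /andP[].
  have n1 : next [:: w1; w2] w1 = w2 by rewrite /= eqxx.
  have n2 : next [:: w1; w2] w2 = w1 by rewrite /= ?(negPf w21) ?[w1 == w2]eq_sym ?(negPf w21) ?eqxx.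
  have := cornerW w1 (mem_head _ _); rewrite n1 => -[p [q [hp hq _ _ c1]]].
  have := cornerW w2; rewrite n2 !inE eqxx orbT.
  move=> /(_ isT) [q' [p' [hq' hp' _ _ c2]]].
  move: c2; rewrite (same _ _ _ hq' hq) (same _ _ _ hp' hp) segmentC.
  have /andP[e12 _] := Wsorted.
  have /andP[f1 f2] := cyc_between e12 c1.
  move=> /(cyc_outside (ltW e12))[|].
    by move/(lt_trans f2); rewrite ltxx.
  by move=> f3; have := lt_trans f1 f3; rewrite ltxx.
(* Three consecutive edges [pn p1], [p1 p2], [p2 p3] of the base, in clockwise order,
   are compared; [pn] and [p3] may coincide. *)
set ws := [:: w1, w2, w3 & t] in W1 W2 W3 Wsorted edgeW cornerW w0ws *.
have w1ws : w1 \in ws by rewrite mem_head.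
have w2ws : w2 \in ws by rewrite !inE eqxx orbT.
have w3ws : w3 \in ws by rewrite !inE eqxx !orbT.
have n1 : next ws w1 = w2 by rewrite /= eqxx.
have n2 : next ws w2 = w3.
  have w21 : w2 != w1 by move: W1; rewrite /= inE negb_or eq_sym => /andP[/andP[]].
  by rewrite /= ?(negPf w21) ?[w1 == w2]eq_sym ?(negPf w21) ?eqxx.
set wn := prev ws w1; have nn : next ws wn = w1 by apply: next_prev.
have wnws : wn \in ws by rewrite mem_prev.
have /= /and3P[e12 e23 _] := Wsorted.
have e1min : e w1 <= e wn.
  have := order_path_min lt_trans Wsorted; move/allP => min.
  move: wnws; rewrite inE => /predU1P[->//|wnt].
  by apply/ltW/min; exact: (map_f e wnt).
have e3n : e w3 <= e wn.
  have [lt|] := @next_sorted _ ws e wn W1 Wsorted wnws.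
    by move: lt; rewrite nn ltNge e1min.
  by move=> /(_ _ w3ws)/andP[].
have := cornerW _ w1ws; rewrite n1 => -[p1 [p2 [h11 h12 u2 N2 c12]]].
have := cornerW _ w2ws; rewrite n2 => -[p2' [p3 [h22 h23 u3 N3 c23]]].
have := cornerW _ wnws; rewrite nn => -[pn [p1' [hnn hn1 u1 N1 cn1]]].
have e2 := same _ _ _ h22 h12; have e1 := same _ _ _ hn1 h11.
rewrite {}e2 in N3 c23; rewrite {}e1 in N1 u1 cn1.
have /andP[f12l f12r] := cyc_between e12 c12.
have /andP[f23l f23r] := cyc_between e23 c23.
have f123 : L (segment p1 p2) < L (segment p2 p3).
  exact: lt_trans f12r f23l.
have p13 : p1 != p3.
  by apply/eqP => p13; move: f123; rewrite -p13 [segment p2 p1]segmentC ltxx.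
have := @next_cyc _ us (fun p => L (segment p (next us p))) p3 U1 sus u3.
rewrite N3 N2 => /(_ p13); rewrite N1.
rewrite [segment p3 p2]segmentC [segment p2 p1]segmentC [segment p1 pn]segmentC.
have [fn|fn] := cyc_outside e1min cn1.
  have f2n : L (segment p2 p3) < L (segment pn p1).
    exact: lt_trans f23r (le_lt_trans e3n fn).
  move=> /or3P[/andP[/(lt_trans f123)]|/andP[_ /(lt_trans f2n)]|/andP[/(lt_trans f2n)]];
    by rewrite ltxx.
have fn1 : L (segment pn p1) < L (segment p1 p2) by exact: lt_trans fn f12l.
move=> /or3P[/andP[/(lt_trans f123)]|/andP[/(lt_trans fn1)]|/andP[_ /(lt_trans f123)]];
  by rewrite ltxx.
Qed.
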